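(* Let $\mathcal{P}\subset\mathbf{G}_d$ be a hyperfinite family. Then for every $\delta>0$ there exists $f(\delta)>0$ such that if $G\in\mathcal{P}$ and $H\in\mathbf{G}_d$ satisfy $|V(G)|=|V(H)|=n$ and $d_{stat}(G,H)<f(\delta)$, then there is a bijection $\rho:V(G)\to V(H)$ such that $$|\rho^{-1}(E(H))\triangle E(G)|<\delta n.$$
   Context: Fix an integer $d\ge 1$. $\mathbf{G}_d$ is the set of finite simple graphs with all vertex degrees at most $d$ (up to isomorphism). $U^r_d$ is the finite set of rooted-isomorphism classes of rooted graphs with degrees at most $d$ in which every vertex is at shortest-path distance at most $r$ from the root. For $G\in\mathbf{G}_d$, $r\ge1$, $\alpha\in U^r_d$: $p(G,\alpha)$ is the proportion of vertices $v$ of $G$ whose $r$-ball, rooted at $v$, is rooted-isomorphic to $\alpha$. Enumerating all pairs $(r,\alpha)$, $r\ge 1$, $\alpha\in U^r_d$, as $\alpha_1,\alpha_2,\dots$, put $\mathcal{L}(G)=(p(G,\alpha_1),p(G,\alpha_2),\dots)\in[0,1]^{\mathbf{N}}$; fix a metric $d_\pi$ on $[0,1]^{\mathbf{N}}$ generating the product topology and set $d_{stat}(G,H)=d_\pi(\mathcal{L}(G),\mathcal{L}(H))$. $\mathcal{P}\subset\mathbf{G}_d$ is a hyperfinite family if for every $\epsilon>0$ there is $K>0$ such that for each $G\in\mathcal{P}$ there is $Z\subset V(G)$ with $|Z|<\epsilon|V(G)|$ such that after removing all edges incident to $Z$ every component of the remaining graph has at most $K$ vertices. $\rho^{-1}(E(H))$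 is the set of pairs $\{x,y\}\subset V(G)$ with $\{\rho(x),\rho(y)\}\in E(H)$. *)

(* Defs.v *)
From HB Require Import structures.
From mathcomp Require Import all_boot all_order all_algebra.
From mathcomp Require Import all_classical all_reals all_analysis.

Set Implicit Arguments.
Unset Strict Implicit.
Unset Printing Implicit Defensive.

Import Order.TTheory GRing.Theory Num.Theory.
Import numFieldTopology.Exports.

Local Open Scope ring_scope.

Record sgraph := SGraph {
  vertex :> finType;
  adj : rel vertex;
  adj_sym : symmetric adj;
  adj_irr : irreflexive adj }.

(* Membership in G_d. The empty graph is allowed; no hyperfinite family
   contains it, because of the strict bound on |Z| below. *)
Definition max_degree_le (d : nat) (G : sgraph) : Prop :=
  forall x : G, (#|adj x| <= d)%N.

Definition edges (G : sgraph) : {set {set G}} :=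
  [set [set p.1; p.2] | p : G * G & adj p.1 p.2].

Record rooted_graph := RootedGraph {
  unrooted :> sgraph;
  rg_root : unrooted }.

Definition riso (A B : rooted_graph) : Prop :=
  exists f : A -> B,
    [/\ bijective f, f (rg_root A) = rg_root B & forall x y, adj (f x) (f y) = adj x y].

(* The shortest-path distance from x to y is at most r: some walk with at most
   r edges goes from x to y. *)
Definition dist_le (G : sgraph) (r : nat) (x y : G) : bool :=
  [exists k : 'I_r.+1, [exists s : k.-tuple G, path (@adj G) x s && (last x s == y)]].

Lemma dist_le_refl (G : sgraph) (r : nat) (x : G) : dist_le r x x.
Proof.
apply/existsP; exists ord0; apply/existsP; exists [tuple of [::]].
by rewrite /= eqxx.
Qed.

Section Ball.
Variables (G : sgraph) (r : nat) (v : G).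

Let ball_vertex : finType := {w : G | dist_le r v w}.
Let ball_adj : rel ball_vertex := fun x y => adj (val x) (val y).

Let ball_adj_sym : symmetric ball_adj.
Proof. by move=> x y; rewrite /ball_adj adj_sym. Qed.

Let ball_adj_irr : irreflexive ball_adj.
Proof. by move=> x; rewrite /ball_adj adj_irr. Qed.

Definition rball : rooted_graph :=
  @RootedGraph (SGraph ball_adj_sym ball_adj_irr) (exist _ v (dist_le_refl r v)).

End Ball.

(* The rooted-isomorphism class of A belongs to U^r_d. *)
Definition in_U (d r : nat) (A : rooted_graph) : Prop :=
  max_degree_le d A /\ forall x : A, dist_le r (rg_root A) x.

(* alpha lists all pairs (r, class in U^r_d) with r >= 1, each exactly once;
   a class is given by a representative. *)
Definition enumerates_U (d : nat) (alpha : nat -> nat * rooted_graph) : Prop :=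
  (forall i, (1 <= (alpha i).1)%N /\ in_U d (alpha i).1 (alpha i).2) /\
  (forall r A, (1 <= r)%N -> in_U d r A ->
     exists! i, (alpha i).1 = r /\ riso (alpha i).2 A).

Section Statistics.
Variable R : realType.

(* [0,1]^N with the product topology. *)
Definition cube : topologicalType :=
  {ptws nat -> set_type (`[0, 1]%classic : set R)}.

Definition freq (G : sgraph) (r : nat) (A : rooted_graph) : R :=
  #|[set v : G | `[< riso (rball r v) A >]]|%:R / #|G|%:R.

Lemma freq_itv (G : sgraph) (r : nat) (A : rooted_graph) :
  freq G r A \in (`[0, 1]%classic : set R).
Proof.
apply: mem_set; rewrite /= in_itv /= /freq divr_ge0 ?ler0n //=.
have [->|n0] := posnP #|G|; first by rewrite invr0 mulr0 ler01.
by rewrite ler_pdivrMr ?ltr0n // mul1r ler_nat max_card.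
Qed.

Definition stat (alpha : nat -> nat * rooted_graph) (G : sgraph) : cube :=
  fun i => exist _ (freq G (alpha i).1 (alpha i).2) (freq_itv G _ _).

Definition is_metric (T : Type) (dist : T -> T -> R) : Prop :=
  [/\ forall x y, 0 <= dist x y,
      forall x y, dist x y = 0 <-> x = y,
      forall x y, dist x y = dist y x &
      forall x y z, dist x z <= dist x y + dist y z].

Definition generates_topology (T : topologicalType) (dist : T -> T -> R) : Prop :=
  forall U : set T, open U <->
    forall x, U x -> exists2 e, 0 < e & forall y, dist x y < e -> U y.

Definition d_stat (dpi : cube -> cube -> R) (alpha : nat -> nat * rooted_graph)
    (G H : sgraph) : R :=
  dpi (stat alpha G) (stat alpha H).

(* The adjacency relation after deletion of all edges incident to Z. *)
Definition adj_off (G : sgraph) (Z : {set G}) : rel G :=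
  fun x y => [&& adj x y, x \notin Z & y \notin Z].

Definition hyperfinite (P : sgraph -> Prop) : Prop :=
  forall eps : R, 0 < eps ->
  exists2 K : nat, (0 < K)%N &
  forall G : sgraph, P G ->
  exists2 Z : {set G}, #|Z|%:R < eps * #|G|%:R &
  forall x : G, (#|connect (adj_off Z) x| <= K)%N.

End Statistics.

Definition edge_preim (G H : sgraph) (rho : G -> H) : {set {set G}} :=
  [set [set p.1; p.2] | p : G * G & [set rho p.1; rho p.2] \in edges H].

Definition symdiff (T : finType) (A B : {set T}) : {set T} :=
  (A :\: B) :|: (B :\: A).

(* Main.v *)
(* Both graphs are cut into small pieces by the same random local procedure. In
each of T rounds every surviving vertex is activated by a fair coin; a connected
component of the active vertices is extracted as a piece if it has at most K
vertices and few edges to the other surviving vertices. Pieces cost few cut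
edges by construction. In a hyperfinite graph, whatever survives, most survivors
lie in a connected set that would be extracted if exactly its vertices were
activated in a ball of radius K, which has probability bounded below; hence the
expected number of vertices left after many rounds is small. The isomorphism
type of the piece of v, and whether v is left over, depend only on the labelled
ball around v, so their expected frequencies in G and in H are close when the
ball statistics are. A second moment bound gives, when n is large, labellings of
both graphs that realise these frequencies approximately, and matching pieces of
equal type yields rho. When n is bounded, close statistics have to be equal and
the components themselves can be matched. *)

Require Import Defs.
From HB Require Import structures.
From mathcomp Require Import all_boot all_order all_algebra.
From mathcomp Require Import all_classical all_reals all_analysis.
From mathcomp Require Import zify ring lra.
(* Imported again because all_classical shadows many lemmas on finite sets. *)
From mathcomp Require Import fintype bigop finset.

Set Implicit Arguments.
Unset Strict Implicit.
Unset Printing Implicit Defensive.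

Import Order.TTheory GRing.Theory Num.Theory.
Import numFieldTopology.Exports.

Local Open Scope ring_scope.

(** * Balls, components and their transport along locally adjacency-preserving bijections *)

Section Locality.
Local Open Scope nat_scope.

Fixpoint nball (V : finType) (e : rel V) (k : nat) (v : V) : {set V} :=
  if k is k'.+1 then
    nball e k' v :|: [set y | [exists x in nball e k' v, e x y]]
  else [set v].

(** Only [x] is confined to the ball: [y] ranges over the whole graph, so edges and non-edges
    leaving the ball are respected too. Working with a map between whole graphs avoids dependent
    types of balls. *)
Definition loceq (V W : finType) (e : rel V) (e' : rel W) (s : V -> W)
    (k : nat) (v : V) : Prop :=
  forall x y, x \in nball e k v -> e' (s x) (s y) = e x y.

Definition relX (V : finType) (e : rel V) (X : {set V}) : rel V :=
  fun x y => [&& e x y, x \in X & y \in X].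

Section Balls.
Variables (V : finType) (e : rel V).
Implicit Types (v x y : V) (k : nat).

Lemma nballSP k v y :
  reflect (y \in nball e k v \/ exists2 x, x \in nball e k v & e x y)
          (y \in nball e k.+1 v).
Proof.
rewrite /= !inE; apply: (iffP orP) => -[?|H]; first by left.
- by right; case/exists_inP: H => x; exists x.
- by left.
- by right; apply/exists_inP; case: H => x; exists x.
Qed.

Lemma nball_step k v x y : x \in nball e k v -> e x y -> y \in nball e k.+1 v.
Proof. by move=> xv exy; apply/nballSP; right; exists x. Qed.

Lemma nball_self k v : v \in nball e k v.
Proof. by elim: k => [|k IH] /=; rewrite inE ?eqxx ?IH. Qed.

Lemma nball_sub k k' v : k <= k' -> nball e k v \subset nball e k' v.
Proof.
move=> /subnK <-; elim: (k' - k) => [|j IH]; first by rewrite add0n.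
by rewrite addSn /=; apply: (subset_trans IH); apply: subsetUl.
Qed.

Lemma nball_trans j k v x y :
  x \in nball e j v -> y \in nball e k x -> y \in nball e (j + k) v.
Proof.
move=> xv; elim: k y => [|k IH] y; first by rewrite inE addn0 => /eqP->.
case/nballSP => [yx|[z zx ezy]]; rewrite addnS.
  exact: subsetP (nball_sub _ (leqnSn _)) _ (IH _ yx).
exact: nball_step (IH _ zx) ezy.
Qed.

Lemma nball_sym k v y : symmetric e -> y \in nball e k v -> v \in nball e k y.
Proof.
move=> es; elim: k y => [|k IH] y; first by rewrite !inE eq_sym.
case/nballSP => [yv|[x xv exy]].
  exact: subsetP (nball_sub _ (leqnSn _)) _ (IH _ yv).
rewrite -add1n; apply: nball_trans (IH _ xv).
by apply: nball_step (nball_self _ _) _; rewrite es.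
Qed.

Lemma nball_connect k v y : y \in nball e k v -> connect e v y.
Proof.
elim: k y => [|k IH] y; first by rewrite inE => /eqP->.
case/nballSP => [/IH //|[x /IH vx exy]].
exact: connect_trans vx (connect1 exy).
Qed.

Lemma path_nball v p : path e v p -> last v p \in nball e (size p) v.
Proof.
elim/last_ind: p => [|p x IH]; first by rewrite inE.
rewrite rcons_path size_rcons last_rcons => /andP[/IH vp ex].
exact: nball_step vp ex.
Qed.

(** A repetition-free path inside a component of at most [k] vertices has at most [k - 1] edges. *)
Lemma connect_nball k v y :
  #|connect e v| <= k -> connect e v y -> y \in nball e k.-1 v.
Proof.
move=> ck /connectP [p pp ->{y}].
case/shortenP: pp => q qp uq _.
apply: (subsetP (nball_sub _ _)) (path_nball qp).
suff: size (v :: q) <= #|connect e v| by move=> /leq_trans /(_ ck) /=; case: (k).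
rewrite cardE uniq_leq_size // => z zq.
rewrite mem_enum; have: connect e v z by apply: path_connect zq.
by [].
Qed.

Lemma card_nball d k v :
  (forall x, #|e x| <= d) -> #|nball e k v| <= d.+1 ^ k.
Proof.
move=> deg; elim: k => [|k IH]; first by rewrite cards1.
apply: (@leq_trans (d.+1 * #|nball e k v|)); last by rewrite expnS leq_mul2l IH orbT.
rewrite mulSn; apply: leq_trans (leq_card_setU _ _) _; rewrite leq_add2l.
have -> : [set y | [exists x in nball e k v, e x y]]
   = \bigcup_(x in nball e k v) [set y | e x y].
  apply/setP => y; rewrite inE; apply/exists_inP/bigcupP => -[x xv].
    by exists x => //; rewrite inE.
  by rewrite inE; exists x.
apply: leq_trans (_ : \sum_(x in nball e k v) #|[set y | e x y]| <= _).
  elim/big_rec2: _ => [|x n A _ H]; first by rewrite cards0.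
  by apply: leq_trans (leq_card_setU _ _) _; rewrite leq_add2l.
rewrite mulnC -sum_nat_const; apply: leq_sum => x _.
by apply: leq_trans (deg x); rewrite cardsE.
Qed.

Lemma connect_closed (D : pred V) x y :
  (forall z w, z \in D -> e z w -> w \in D) -> x \in D -> connect e x y -> y \in D.
Proof.
move=> H xD /connectP[p pp ->]; elim: p x xD pp => //= z p IH x xD /andP[exz].
exact/IH/(H x).
Qed.

End Balls.

Lemma nball_subrel (V : finType) (e1 e2 : rel V) k v :
  subrel e1 e2 -> nball e1 k v \subset nball e2 k v.
Proof.
move=> s; elim: k => [|k IH] //; apply/subsetP => y /nballSP[|[x xv exy]].
  by move/(subsetP IH) => ?; apply/nballSP; left.
by apply: nball_step (s _ _ exy); apply: (subsetP IH).
Qed.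

Section Transport.
Variables (V W : finType) (e : rel V) (e' : rel W) (s : V -> W).
Hypothesis s_bij : bijective s.

(** The radius may reach [k.+1] because [loceq] controls every edge that starts in the [k]-ball,
    wherever it ends. *)
Lemma loceq_nball k v j y : loceq e e' s k v -> j <= k.+1 ->
  (s y \in nball e' j (s v)) = (y \in nball e j v).
Proof.
have [s' sK s'K] := s_bij.
move=> L; elim: j y => [|j IH] y jk; first by rewrite !inE (inj_eq (can_inj sK)).
apply/nballSP/nballSP.
  move=> [|[z]]; first by rewrite IH 1?ltnW //; left.
  rewrite -{1}(s'K z) IH 1?ltnW // => zv.
  rewrite -{1}(s'K z) L; first by right; exists (s' z).
  exact: (subsetP (@nball_sub _ e j k v jk)).
move=> [yv|[x xv exy]]; first by left; rewrite IH // ltnW.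
right; exists (s x); first by rewrite IH // ltnW.
by rewrite L //; exact: (subsetP (@nball_sub _ e j k v jk)).
Qed.

Lemma loceq_sub j k v x : loceq e e' s (j + k) v -> x \in nball e j v ->
  loceq e e' s k x.
Proof. by move=> L xv y z yx; apply: L; apply: nball_trans yx. Qed.

Lemma loceq_le j k v : loceq e e' s k v -> j <= k -> loceq e e' s j v.
Proof. by move=> L jk x y xv; apply: L; apply: (subsetP (nball_sub e v jk)). Qed.

(** The whole component of [v] lies in the [k]-ball, so its image is closed under [e'] and no
    [e']-path can escape from it. *)
Lemma loceq_connect k v y : loceq e e' s k v -> #|connect e v| <= k ->
  connect e' (s v) (s y) = connect e v y.
Proof.
have [s' sK s'K] := s_bij.
move=> L ck; have kb z : connect e v z -> z \in nball e k v.
  move=> vz; apply: (subsetP (nball_sub e v (leq_pred k))).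
  exact: connect_nball.
apply/idP/idP.
  move=> vy; suff: s y \in [pred z | connect e v (s' z)] by rewrite inE sK.
  apply: connect_closed vy; last by rewrite inE sK connect0.
  move=> z w; rewrite !inE => vz ezw.
  apply: (connect_trans vz); apply: connect1.
  by rewrite -L ?s'K ?s'K //; apply: kb.
move=> vy; apply: (nball_connect (k := k)).
by rewrite (loceq_nball _ L) ?leqnSn // kb.
Qed.

Lemma loceq_connect_card k v : loceq e e' s k v -> #|connect e v| <= k ->
  #|connect e' (s v)| = #|connect e v|.
Proof.
have [s' sK s'K] := s_bij.
move=> L ck; rewrite -(card_imset (connect e v) (can_inj sK)).
apply: eq_card => z; rewrite -(s'K z) mem_imset; last exact: can_inj sK.
exact: (loceq_connect _ L).
Qed.

(** [X] and [Y] have to correspond one step beyond the [k]-ball, since membership of the far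
    endpoint of an edge matters. *)
Lemma loceq_relX k v (X : {set V}) (Y : {set W}) :
  loceq e e' s k v ->
  (forall x, x \in nball e k.+1 v -> (s x \in Y) = (x \in X)) ->
  loceq (relX e X) (relX e' Y) s k v.
Proof.
move=> L XY x y /(subsetP (@nball_subrel _ (relX e X) e k v _)) xv.
have {}xv : x \in nball e k v by apply: xv => ? ? /and3P[].
rewrite /relX L // XY; last by apply: (subsetP (nball_sub e v (leqnSn k))).
have [exy|//] := boolP (e x y); rewrite XY //.
exact: nball_step exy.
Qed.

End Transport.

Lemma loceq_inv (V W : finType) (e : rel V) (e' : rel W) s s' k v :
  cancel s s' -> cancel s' s -> loceq e e' s k v -> loceq e' e s' k (s v).
Proof.
move=> sK s'K L x y xv; rewrite -(s'K x) -(s'K y) !sK L //.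
by rewrite -(loceq_nball _ _ L) ?leqnSn ?s'K //; exists s'.
Qed.

Lemma loceq_connect_le (V W : finType) (e : rel V) (e' : rel W) s k v :
  bijective s -> loceq e e' s k v ->
  (#|connect e' (s v)| <= k) = (#|connect e v| <= k).
Proof.
move=> sb L; have [s' sK s'K] := sb.
have L' := loceq_inv sK s'K L.
apply/idP/idP => H; last by rewrite (loceq_connect_card sb L).
by have := loceq_connect_card (Bijective s'K sK) L' H; rewrite sK => ->.
Qed.

End Locality.

(** * Finite codes for isomorphism types of small rooted components *)

Section Codes.
Local Open Scope nat_scope.

(* A code records which entries of an enumeration, possibly with repetitions,
   coincide and which are related. *)
Definition code_type (K : nat) : finType := {ffun 'I_K.+1 * 'I_K.+1 -> bool * bool}.

Definition pattern (K : nat) (V : finType) (e : rel V) (g : 'I_K.+1 -> V) :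
    code_type K :=
  [ffun p => (g p.1 == g p.2, e (g p.1) (g p.2))].

(** The enumeration starts at the root [v] and exhausts its component. Codes are not canonical: a
    vertex can have several, one for each enumeration, but a shared code always yields an
    isomorphism. *)
Definition hascode (K : nat) (V : finType) (e : rel V) (c : code_type K) (v : V) : bool :=
  [exists g : {ffun 'I_K.+1 -> V},
    [&& g ord0 == v, [forall y, connect e v y == (y \in codom g)]
      & pattern e g == c]].

Lemma hascodeP (K : nat) (V : finType) (e : rel V) (c : code_type K) (v : V) :
  reflect (exists g : 'I_K.+1 -> V, [/\ g ord0 = v,
             forall y, connect e v y <-> exists i, g i = y
           & pattern e g = c])
          (hascode e c v).
Proof.
apply: (iffP existsP) => [[g /and3P[/eqP g0 /forallP gy /eqP gc]]|[g [g0 gy gc]]].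
  exists g; split=> // y; rewrite (eqP (gy y)).
  by split=> [/codomP|] [i]; [move=> ->; exists i | move=> <-; apply: codom_f].
exists [ffun i => g i]; rewrite ffunE g0 eqxx /=; apply/andP; split.
  apply/forallP => y; apply/eqP; apply/idP/idP => [/gy[i <-]|/codomP[i ->]].
    by apply/codomP; exists i; rewrite ffunE.
  by apply/gy; exists i; rewrite ffunE.
by apply/eqP; rewrite -gc; apply/ffunP => p; rewrite !ffunE.
Qed.

Lemma enum_onto (K : nat) (V : finType) (A : {pred V}) (v : V) :
  v \in A -> #|A| <= K.+1 ->
  exists g : 'I_K.+1 -> V, g ord0 = v /\ forall y, y \in A <-> exists i, g i = y.
Proof.
move=> vA cA; pose q := v :: enum [predD1 A & v].
have qA y : (y \in q) = (y \in A).
  by rewrite inE mem_enum !inE; case: eqP => [->|].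
have sq : size q <= K.+1 by rewrite /= -cardE; move: cA; rewrite (cardD1 v) vA.
exists (fun i => nth v q i); split=> // y; split=> [|[i <-]].
  rewrite -qA => yq; have iq : index y q < K.+1.
    by apply: leq_trans sq; rewrite index_mem.
  by exists (Ordinal iq); rewrite nth_index.
rewrite -qA; case: (ltnP i (size q)) => H; first exact: mem_nth.
by rewrite nth_default // mem_head.
Qed.

Lemma hascode_ex (K : nat) (V : finType) (e : rel V) (v : V) :
  #|connect e v| <= K.+1 -> exists c : code_type K, hascode e c v.
Proof.
move=> ck; have [] := @enum_onto K V (connect e v) v _ ck; first exact: connect0.
by move=> g [g0 gy]; exists (pattern e g); apply/hascodeP; exists g.
Qed.

Lemma loceq_hascode_imp (K : nat) (V W : finType) (e : rel V) (e' : rel W) s k v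
    (c : code_type K) : bijective s -> loceq e e' s k v -> #|connect e v| <= k ->
  hascode e c v -> hascode e' c (s v).
Proof.
move=> sb L ck /hascodeP[g [g0 gy gc]]; have [s' sK s'K] := sb.
apply/hascodeP; exists (s \o g); split=> [|y|]; first by rewrite /= g0.
  rewrite -(s'K y) (loceq_connect sb _ L ck).
  split=> [/gy|] [i /= H]; first by exists i; rewrite H.
  by apply/gy; exists i; apply: (can_inj sK).
rewrite -gc; apply/ffunP => p; rewrite !ffunE /= (inj_eq (can_inj sK)) L //.
have /(connect_nball ck) : connect e v (g p.1) by apply/gy; exists p.1.
exact: (subsetP (nball_sub e v (leq_pred k))).
Qed.

Lemma loceq_hascode (K : nat) (V W : finType) (e : rel V) (e' : rel W) s k v
    (c : code_type K) : bijective s -> loceq e e' s k v -> #|connect e v| <= k ->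
  hascode e' c (s v) = hascode e c v.
Proof.
move=> sb L ck; have [s' sK s'K] := sb; apply/idP/idP; last exact: (loceq_hascode_imp sb L ck).
have := @loceq_hascode_imp K _ _ e' e s' k (s v) c (Bijective s'K sK) (loceq_inv sK s'K L).
by rewrite sK (loceq_connect_le sb L); apply.
Qed.

(** Equal patterns make the correspondence from [g i] to [g' i] well defined and injective, since
    they record coincidences, and adjacency preserving, since they record edges. *)
Lemma hascode_iso (K : nat) (V W : finType) (e : rel V) (e' : rel W)
    (c : code_type K) x w : hascode e c x -> hascode e' c w ->
  exists h : V -> W, [/\ {in connect e x &, injective h},
    forall z, connect e x z -> connect e' w (h z) &
    {in connect e x &, forall y z, e' (h y) (h z) = e y z}] /\ h x = w.
Proof.
move=> /hascodeP[g [g0 gy gc]] /hascodeP[g' [g'0 g'y g'c]].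
have same i j : (g i == g j) = (g' i == g' j) /\ e (g i) (g j) = e' (g' i) (g' j).
  by have := congr1 (fun f : code_type K => f (i, j)) (etrans gc (esym g'c));
    rewrite !ffunE /= => -[].
pose ix z := odflt ord0 [pick i | g i == z].
have ixK z : connect e x z -> g (ix z) = z.
  move=> /gy[i gi]; rewrite /ix; case: pickP => [j /eqP //|/(_ i)].
  by rewrite gi eqxx.
exists (g' \o ix); split; last first.
  rewrite /= -g'0; apply/eqP; rewrite -(same _ _).1 ixK ?g0 //.
split=> [y z /ixK yx /ixK zx /= /eqP|z xz|y z /ixK yx /ixK zx /=].
- by rewrite -(same _ _).1 yx zx => /eqP.
- by apply/g'y; exists (ix z).
- by rewrite -(same _ _).2 yx zx.
Qed.

End Codes.

(** * Matching isomorphic components of two graphs of equal order *)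

Section Matching.
Local Open Scope nat_scope.

(** The complements of [D] and of its image have equal size, so the map is continued by matching
    their enumerations in order. *)
Lemma extend_inj (V W : finType) (D : {set V}) (f : V -> W) :
  #|V| = #|W| -> {in D &, injective f} ->
  exists2 g : V -> W, bijective g & {in D, g =1 f}.
Proof.
move=> cVW fi; pose E := f @: D.
have cE : #|~: D| = #|~: E|.
  by apply: (@addnI #|D|); rewrite cardsC -(card_in_imset fi) cardsC.
pose h x := nth (f x) (enum (~: E)) (index x (enum (~: D))).
pose g x := if x \in D then f x else h x.
have hE x : x \notin D -> h x \in ~: E.
  move=> xD; rewrite -mem_enum /h; apply: mem_nth.
  by rewrite -cardE -cE cardE index_mem mem_enum inE.
have gi : injective g.
  move=> x y; rewrite /g; case: ifP => xD; case: ifP => yD H.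
  - exact: fi.
  - by have := hE y (negbT yD); rewrite inE -H imset_f.
  - by have := hE x (negbT xD); rewrite inE H imset_f.
  - have ix : index x (enum (~: D)) < size (enum (~: E)).
      by rewrite -cardE -cE cardE index_mem mem_enum inE xD.
    have iy : index y (enum (~: D)) < size (enum (~: E)).
      by rewrite -cardE -cE cardE index_mem mem_enum inE yD.
    move/eqP: H; rewrite /h (set_nth_default (f x) (f y)) // nth_uniq ?enum_uniq //.
    move/eqP => H.
    rewrite -(nth_index x (_ : x \in enum (~: D))) ?mem_enum ?inE ?xD // H.
    by rewrite nth_index // mem_enum inE yD.
exists g; first by apply: inj_card_bij; rewrite ?cVW.
by move=> x xD; rewrite /g xD.
Qed.

Section Good.
Variables (V W : finType) (e : rel V) (e' : rel W).
Hypotheses (es : symmetric e) (es' : symmetric e').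

(** As [z] is unrestricted, [rho] carries the component of an intact vertex onto an entire component
    of [e']. *)
Definition intact (rho : V -> W) : {set V} :=
  [set x | [forall y, forall z,
     connect e x y ==> (e' (rho y) (rho z) == e y z)]].

Lemma intactP rho x :
  reflect (forall y z, connect e x y -> e' (rho y) (rho z) = e y z) (x \in intact rho).
Proof.
rewrite inE; apply: (iffP forallP) => H y.
  by move=> z xy; have /forallP/(_ z) := H y; rewrite xy => /eqP.
by apply/forallP => z; apply/implyP => xy; rewrite H.
Qed.

Lemma closed_intact (rho : V -> W) (D : {set V}) : bijective rho ->
  (forall x y, x \in D -> e x y -> y \in D) ->
  (forall x z, x \in D -> e' (rho x) z -> z \in rho @: D) ->
  {in D &, forall x y, e' (rho x) (rho y) = e x y} -> D \subset intact rho.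
Proof.
move=> [r' rK r'K] cD cD' pD; apply/subsetP => x xD; apply/intactP => y z xy.
have yD : y \in D by apply: connect_closed xy.
have [zD|zD] := boolP (z \in D); first exact: pD.
apply/idP/idP => [/(cD' _ _ yD)|/(cD _ _ yD)]; last by rewrite (negPf zD).
by rewrite mem_imset ?(negPf zD) //; apply: can_inj rK.
Qed.

(** Otherwise [rho] could be kept on the intact vertices, redefined on the component of [x] as an
    isomorphism onto that of [w], and extended arbitrarily. The new bijection would have more intact
    vertices, against maximality. *)
Lemma no_common_code K (c : code_type K) (rho : V -> W) (x : V) (w : W) :
  #|V| = #|W| -> bijective rho ->
  (forall r : V -> W, bijective r -> #|intact r| <= #|intact rho|) ->
  x \notin intact rho -> w \notin rho @: intact rho ->
  hascode e c x -> hascode e' c w -> False.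
Proof.
move=> cVW rb rmax xI wI cx cw.
have [h [[hi hc hp] hx]] := hascode_iso cx cw.
have [h' [[hi' hc' hp'] hx']] := hascode_iso cw cx.
set I := intact rho in xI wI rmax.
have cs := sym_connect_sym es; have cs' := sym_connect_sym es'.
have Icl y z : y \in I -> e y z -> z \in I.
  move=> /intactP yI yz; apply/intactP => a b za; apply: yI.
  exact: connect_trans (connect1 yz) za.
have Icl' y z : y \in I -> e' (rho y) z -> z \in rho @: I.
  have [r' rK r'K] := rb; move=> yI; rewrite -{1}(r'K z).
  have /intactP -> // := yI => yz; rewrite -(r'K z) imset_f //.
  exact: Icl yz.
pose C := [set y | connect e x y].
have xC : x \in C by rewrite inE.
have CI y : y \in C -> y \notin I.
  rewrite inE => xy; apply: contra xI => yI.
  by apply: (connect_closed Icl yI); rewrite cs.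
have wI' z : connect e' w z -> z \notin rho @: I.
  move=> wz; apply: contra wI => zI; rewrite cs' in wz.
  apply: (connect_closed _ zI wz) => a b /imsetP[y yI ->]; exact: Icl'.
(* h is onto the component of w by counting, h' being injective the other way *)
have hC : h @: C = [set z | connect e' w z].
  apply/eqP; rewrite eqEcard; apply/andP; split.
    by apply/subsetP => _ /imsetP[y yC ->]; rewrite inE; apply: hc; rewrite inE in yC.
  rewrite card_in_imset; last by move=> a b; rewrite !inE; apply: hi.
  rewrite -(card_in_imset (f := h')); last by move=> a b; rewrite !inE; apply: hi'.
  apply: subset_leq_card; apply/subsetP => _ /imsetP[y yC ->]; rewrite inE.
  by apply: hc'; rewrite inE in yC.
pose f y := if y \in I then rho y else h y.
have [|r rb' rf] := @extend_inj V W (I :|: C) f cVW.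
  have [r' rK r'K] := rb.
  move=> a b; rewrite !in_setU /f.
  have [aI _|aI /= aC] := boolP (a \in I); have [bI _|bI /= bC] := boolP (b \in I).
  - exact: (can_inj rK).
  - have : h b \notin rho @: I by apply/wI'/hc; rewrite inE in bC.
    by move=> + H; rewrite -H imset_f.
  - have : h a \notin rho @: I by apply/wI'/hc; rewrite inE in aC.
    by move=> + H; rewrite H imset_f.
  - by rewrite !inE in aC bC; apply: hi.
have rI : {in I, r =1 rho} by move=> y yI; rewrite rf ?in_setU ?yI // /f yI.
have rC : {in C, r =1 h}.
  by move=> y yC; rewrite rf ?in_setU ?yC ?orbT // /f (negPf (CI _ yC)).
have s1 : I \subset intact r.
  apply: closed_intact => // [y z yI|y z yI zI].
    by rewrite rI // => /(Icl' _ _ yI); rewrite (eq_in_imset rI).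
  by rewrite !rI //; move/intactP: yI; apply.
have s2 : C \subset intact r.
  apply: closed_intact => // [y z|y z yC|y z yC zC].
  - by rewrite !inE => xy yz; apply: connect_trans xy (connect1 yz).
  - rewrite rC // (eq_in_imset rC) hC inE => yz; apply: connect_trans (connect1 yz).
    by apply: hc; rewrite inE in yC.
  - by rewrite !rC // hp //; move: yC zC; rewrite !inE.
have := rmax r rb'; rewrite leqNgt => /negP; apply.
apply: (@leq_trans #|I :|: [set x]|); last first.
  apply: subset_leq_card; rewrite subUset s1 /= sub1set.
  exact: (subsetP s2).
by rewrite setUC cardsU1 xI.
Qed.

(** Extremal choice: [rho] is a bijection with the most intact vertices, and [B] is the set of
    vertices that are not intact. *)
Lemma match_components K : #|V| = #|W| ->
  (forall x, #|connect e x| <= K.+1) -> (forall x, #|connect e' x| <= K.+1) ->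
  exists2 rho : V -> W, bijective rho &
  exists B : {set V},
    #|B| <= \sum_(c : code_type K) (#|[set x | hascode e c x]| - #|[set x | hascode e' c x]|)
    /\ forall x y, x \notin B -> e' (rho x) (rho y) = e x y.
Proof.
move=> cVW ce ce'.
have [r0 r0b _] := @extend_inj V W set0 (fun x => enum_val (cast_ord cVW (enum_rank x))) cVW
  (fun x y xS => ltac:(by rewrite inE in xS)).
have r0i : injectiveb [ffun x => r0 x].
  by apply/injectiveP => x y; rewrite !ffunE; apply: bij_inj.
have [rho /injectiveP rhoi rhomax] :=
  @arg_maxnP _ [ffun x => r0 x] (fun r : {ffun V -> W} => injectiveb r)
     (fun r => #|intact r|) r0i.
have rb : bijective rho by apply: inj_card_bij; rewrite ?cVW.
have rmax r : bijective r -> #|intact r| <= #|intact rho|.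
  move=> rbi; apply: leq_trans (rhomax [ffun x => r x] _).
    apply: subset_leq_card; apply/subsetP => x /intactP H; apply/intactP => y z xy.
    by rewrite !ffunE H.
  by apply/injectiveP => x y; rewrite !ffunE; apply: bij_inj.
exists rho => //; exists (~: intact rho); split; last first.
  by move=> x y; rewrite inE negbK => /intactP; apply.
pose I := intact rho.
have c1 (c : code_type K) : #|[set x in ~: I | hascode e c x]| <=
     #|[set x | hascode e c x]| - #|[set x | hascode e' c x]|.
  (* If a non-intact vertex has code [c], then by maximality every vertex of [W] with code [c] is
     the image of an intact one. The non-intact vertices with code [c] are then exactly the excess
     of the first count over the second. *)
  case: (set_0Vmem [set x in ~: I | hascode e c x]) => [->|[x]]; first by rewrite cards0.
  rewrite 2!inE => /andP[xI cx].
  have eqI : #|[set x in I | hascode e c x]| = #|[set w in rho @: I | hascode e' c w]|.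
    rewrite -(card_imset _ rhoi); apply: eq_card => w; rewrite [RHS]inE.
    apply/imsetP/andP.
      move=> [y]; rewrite inE => /andP[yI yc] ->; rewrite imset_f //; split=> //.
      rewrite (@loceq_hascode _ _ _ e e' rho K.+1) // => a b /nball_connect ya.
      by have /intactP := yI; apply.
    move=> [/imsetP[y yI ->]] yc; exists y => //; rewrite inE yI.
    move: yc; rewrite (@loceq_hascode _ _ _ e e' rho K.+1) // => a b /nball_connect ya.
    by have /intactP := yI; apply.
  have -> : #|[set x | hascode e c x]| =
     #|[set x in I | hascode e c x]| + #|[set x in ~: I | hascode e c x]|.
    rewrite -(cardsID I); congr (_ + _); apply: eq_card => y; rewrite !inE andbC //.
  have -> : [set w | hascode e' c w] = [set w in rho @: I | hascode e' c w].
    apply/setP => w; rewrite !inE; have [//|wI] := boolP (w \in rho @: I).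
    apply/negbTE/negP => cw; exact: (no_common_code cVW rb rmax xI wI cx cw).
  by rewrite eqI addKn.
apply: (@leq_trans (\sum_(c : code_type K) #|[set x in ~: I | hascode e c x]|));
  last by apply: leq_sum => c _; apply: c1.
apply: leq_trans (_ : #|\bigcup_(c : code_type K) [set x in ~: I | hascode e c x]| <= _).
  apply: subset_leq_card; apply/subsetP => x xI; have [c cx] := hascode_ex (ce x).
  by apply/bigcupP; exists c => //; rewrite inE xI.
elim/big_rec2: _ => [|c n A _ H]; first by rewrite cards0.
by apply: leq_trans (leq_card_setU _ _) _; rewrite leq_add2l.
Qed.

End Good.
End Matching.

(** * Counting the edges on which two graphs disagree *)

Section EdgeCount.
Local Open Scope nat_scope.

Lemma card_pairs (V W : finType) (B : {set V}) (r : V -> W -> bool) :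
  #|[set p : V * W | (p.1 \in B) && r p.1 p.2]| = \sum_(x in B) #|[set y | r x y]|.
Proof.
rewrite -sum1_card (eq_bigr (fun x => \sum_(y | r x y) 1)); last first.
  by move=> x _; rewrite -sum1_card; apply: eq_bigl => y; rewrite inE.
by rewrite pair_big_dep /=; apply: eq_bigl => p; rewrite inE.
Qed.

Lemma card_pairs_le (V W : finType) (d : nat) (B : {set V}) (r : V -> W -> bool) :
  (forall x, #|[set y | r x y]| <= d) ->
  #|[set p : V * W | (p.1 \in B) && r p.1 p.2]| <= d * #|B|.
Proof. by move=> deg; rewrite card_pairs mulnC -sum_nat_const leq_sum. Qed.

Lemma eq_set2 (T : finType) (a b x y : T) : [set a; b] = [set x; y] ->
  (a = x /\ b = y) \/ (a = y /\ b = x).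
Proof.
move=> H; have M z : (z \in [set a; b]) = (z \in [set x; y]) by rewrite H.
have := M y; have := M x; have := M b; have := M a.
rewrite !inE !eqxx ?orbT => Ma Mb Mx My.
case/orP: (esym Ma) => /eqP Ea; case/orP: (esym Mb) => /eqP Eb; subst a b.
- by left; split=> //; case/orP: My => /eqP.
- by left.
- by right.
- by left; split=> //; case/orP: Mx => /eqP.
Qed.

Lemma mem_edges (G : sgraph) (x y : G) : ([set x; y] \in edges G) = adj x y.
Proof.
apply/imsetP/idP => [[[a b]]|xy]; last by exists (x, y); rewrite ?inE.
by rewrite inE /= => ab /eq_set2[[-> ->]|[-> ->]] //; rewrite adj_sym.
Qed.

(** A disagreeing pair is a lost edge of [G], the pullback of a lost edge of [H], or meets [B]. At
    each vertex of [B] at most [d] edges of either graph are charged, whence [2 * d]. [QG] and [QH]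
    hold ordered pairs, with each lost edge in at least one orientation. *)
Lemma card_symdiff (G H : sgraph) (d : nat) (eG : rel G) (eH : rel H) (rho : G -> H)
    (B : {set G}) (QG : {set G * G}) (QH : {set H * H}) :
  max_degree_le d G -> max_degree_le d H -> bijective rho ->
  subrel eG (@adj G) -> subrel eH (@adj H) ->
  (forall x y, x \notin B -> eH (rho x) (rho y) = eG x y) ->
  (forall x y, adj x y -> ~~ eG x y -> ((x, y) \in QG) || ((y, x) \in QG)) ->
  (forall x y, adj x y -> ~~ eH x y -> ((x, y) \in QH) || ((y, x) \in QH)) ->
  #|symdiff (edge_preim rho) (edges G)| <= #|QG| + #|QH| + 2 * d * #|B|.
Proof.
move=> dG dH [r' rK r'K] sG sH eB hG hH.
pose Q1 := [set p : G * G | (p.1 \in B) && adj p.1 p.2].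
pose Q2 := [set p : G * G | (p.1 \in B) && adj (rho p.1) (rho p.2)].
pose Q3 := [set p : G * G | (rho p.1, rho p.2) \in QH].
pose pr (p : G * G) := [set p.1; p.2].
have sub : symdiff (edge_preim rho) (edges G) \subset pr @: (QG :|: Q3 :|: (Q1 :|: Q2)).
  have mem x y Q : (((x, y) \in Q) || ((y, x) \in Q)) -> [set x; y] \in pr @: Q.
    case/orP => ?; first by apply/imsetP; exists (x, y).
    by apply/imsetP; exists (y, x) => //; rewrite /pr setUC.
  apply/subsetP => E; rewrite in_setU !in_setD => /orP[/andP[EG /imsetP[[x y]]]|].
    rewrite inE /= mem_edges => xy Exy; apply: contraTT EG => EQ.
    rewrite Exy mem_edges negbK; rewrite Exy in EQ; apply: contraR EQ => nxy; apply: mem.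
    rewrite !inE /= xy; have [xB|xB] := boolP (x \in B); first by rewrite !orbT.
    have := hH _ _ xy; have [exy|nexy] := boolP (eH _ _).
      by move: exy; rewrite eB // => /sG; rewrite (negPf nxy).
    by move=> /(_ isT)/orP[]->; rewrite ?orbT.
  move=> /andP[EG /imsetP[[x y]]]; rewrite inE /= => xy Exy.
  rewrite Exy in EG *; apply: mem; rewrite !inE /= xy.
  have [xB|xB] := boolP (x \in B); first by rewrite !orbT.
  have := hG _ _ xy; have [exy|nexy] := boolP (eG _ _).
    move: exy; rewrite -eB // => /sH exy; case/negP: EG.
    by apply/imsetP; exists (x, y) => //; rewrite inE mem_edges.
  by move=> /(_ isT)/orP[]->; rewrite ?orbT.
apply: leq_trans (subset_leq_card sub) _; apply: leq_trans (leq_imset_card _ _) _.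
apply: leq_trans (leq_card_setU _ _) _; apply: leq_add.
  apply: leq_trans (leq_card_setU _ _) _; rewrite leq_add2l.
  rewrite -(card_imset (Q3) (f := fun p => (rho p.1, rho p.2))).
    by apply: subset_leq_card; apply/subsetP => _ /imsetP[p pQ ->]; rewrite inE in pQ.
  by move=> [a b] [a' b'] /= [/(can_inj rK)-> /(can_inj rK)->].
apply: leq_trans (leq_card_setU _ _) _; rewrite -mulnA mul2n -addnn.
apply: leq_add.
  by apply: (@card_pairs_le G G d B (@adj G)) => x; rewrite cardsE; apply: dG.
apply: (@card_pairs_le G G d B (fun x y => adj (rho x) (rho y))) => x.
rewrite -(card_imset _ (can_inj rK)); apply: leq_trans (dH (rho x)).
by apply: subset_leq_card; apply/subsetP => z /imsetP[y]; rewrite inE => ? ->.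
Qed.

End EdgeCount.

(** * The extraction procedure for fixed active sets *)

Section Rounds.
Local Open Scope nat_scope.

(** Induction on the size of [B], removing one class at a time. It turns inequalities holding for
    each component into inequalities for unions of components. *)
Lemma class_leq_sum (V : finType) (C : V -> {set V}) (B : {set V}) (f g : V -> nat) :
  (forall x, x \in C x) -> (forall x y, y \in C x -> C y = C x) ->
  (forall x, x \in B -> C x \subset B) ->
  (forall x, x \in B -> \sum_(y in C x) f y <= \sum_(y in C x) g y) ->
  \sum_(y in B) f y <= \sum_(y in B) g y.
Proof.
move=> Cx CC; have [m] := ubnP #|B|; elim: m B => // m IH B Bm CB Cfg.
have [->|[x xB]] := set_0Vmem B; first by rewrite !big_set0.
rewrite [X in X <= _](big_setID (C x)) [X in _ <= X](big_setID (C x)) /=.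
rewrite (setIidPr (CB x xB)); apply: leq_add; first exact: Cfg.
apply: IH => [|y|y]; last by rewrite inE => /andP[_]; apply: Cfg.
  rewrite -ltnS; apply: (leq_trans _ Bm); rewrite ltnS; apply: proper_card; apply/properP.
  split; first exact: subsetDl.
  by exists x => //; rewrite inE Cx.
rewrite inE => /andP[yx yB]; apply/subsetP => z zy; rewrite inE (subsetP (CB y yB)) // andbT.
by apply: contra yx => zx; rewrite -(CC _ _ zx) (CC _ _ zy).
Qed.

Section Partition.
Variables (V : finType) (e : rel V) (K s : nat).

Definition component (X : {set V}) (x : V) : {set V} := [set y | connect (relX e X) x y].

Definition out (U C : {set V}) (x : V) : nat := #|[set y | [&& e x y, y \in U & y \notin C]]|.

(* The tolerated ratio of boundary edges to vertices is 1 / s. *)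
Definition tight (U C : {set V}) : bool :=
  (#|C| <= K) && (s * \sum_(x in C) out U C x <= #|C|).

Definition extracted (U A : {set V}) : {set V} :=
  [set x in U :&: A | tight U (component (U :&: A) x)].

Fixpoint remain (A : nat -> {set V}) (t : nat) : {set V} :=
  if t is t'.+1 then remain A t' :\: extracted (remain A t') (A t') else [set: V].

(** The graph after cutting: its edges run inside extracted components, and leftover vertices are
    isolated. *)
Definition piece (A : nat -> {set V}) (T : nat) : rel V := fun x y =>
  [exists t : 'I_T, [&& e x y, x \in extracted (remain A t) (A t)
                      & y \in component (remain A t :&: A t) x]].

(** An edge between two pieces is recorded from the endpoint extracted first, while the other
    endpoint still survives. This is the orientation in which [tight] bounds it. *)
Definition cut (A : nat -> {set V}) (T : nat) : {set V * V} :=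
  [set p | (p.1 \in remain A T) && e p.1 p.2] :|:
  \bigcup_(t < T) [set p | (p.1 \in extracted (remain A t) (A t)) &&
    [&& e p.1 p.2, p.2 \in remain A t & p.2 \notin component (remain A t :&: A t) p.1]].

(** The vertices whose component of [U :\: Z] meets the boundary condition of [tight]. The size
    condition comes separately, from the choice of [Z]. *)
Definition good (U Z : {set V}) : {set V} :=
  [set u in U :\: Z | s * \sum_(x in component (U :\: Z) u) out U (component (U :\: Z) u) x
                        <= #|component (U :\: Z) u|].

Hypothesis es : symmetric e.

Lemma relX_sym X : symmetric (relX e X).
Proof. by move=> x y; rewrite /relX es; congr (_ && _); rewrite andbC. Qed.

Lemma mem_comp X x : x \in component X x.
Proof. by rewrite inE connect0. Qed.

Lemma comp_eq X x y : y \in component X x -> component X y = component X x.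
Proof.
rewrite inE => xy; apply/setP => z; rewrite !inE.
by rewrite (same_connect (sym_connect_sym (relX_sym X)) xy).
Qed.

Lemma comp_sub (X : {set V}) x : x \in X -> component X x \subset X.
Proof.
move=> xX; apply/subsetP => y; rewrite inE; apply: connect_closed => //.
by move=> z w _ /and3P[].
Qed.

Lemma extracted_sub U A : extracted U A \subset U.
Proof. by apply/subsetP => x; rewrite !inE -andbA => /andP[]. Qed.

Lemma extracted_comp U A x :
  x \in extracted U A -> component (U :&: A) x \subset extracted U A.
Proof.
rewrite inE => /andP[xX xt]; apply/subsetP => y yx; rewrite inE.
by rewrite (subsetP (comp_sub xX)) //= (comp_eq yx).
Qed.

Lemma remain_mono A t t' : t <= t' -> remain A t' \subset remain A t.
Proof.
move=> /subnK <-; elim: (t' - t) => // j IH.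
by rewrite addSn; apply: (subset_trans _ IH); apply: subsetDl.
Qed.

Lemma extracted_inj A t t' x : x \in extracted (remain A t) (A t) ->
  x \in extracted (remain A t') (A t') -> t = t'.
Proof.
suff H u u' : u < u' -> x \in extracted (remain A u) (A u) ->
    x \in extracted (remain A u') (A u') -> False.
  move=> xt xt'; case: (ltngtP t t') => // /H; by [move=> /(_ xt xt') | move=> /(_ xt' xt)].
move=> uu' xu /(subsetP (extracted_sub _ _)) /(subsetP (remain_mono A uu')).
by rewrite inE xu.
Qed.

Lemma card_extracted A T :
  \sum_(t < T) #|extracted (remain A t) (A t)| + #|remain A T| = #|V|.
Proof.
elim: T => [|T IH]; first by rewrite big_ord0 cardsT.
rewrite big_ord_recr /= -IH -addnA; congr (_ + _).
by rewrite -(cardsID (extracted (remain A T) (A T)) (remain A T))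
           (setIidPr (extracted_sub _ _)).
Qed.

Lemma removed A T x : x \notin remain A T ->
  exists t : 'I_T, x \in extracted (remain A t) (A t).
Proof.
elim: T => [|T IH]; first by rewrite inE.
rewrite inE negb_and negbK => /orP[xT|/IH[t xt]]; first by exists ord_max.
by exists (widen_ord (leqnSn T) t).
Qed.

Lemma piece_sub A T : subrel (piece A T) e.
Proof. by move=> x y /existsP[t /and3P[]]. Qed.

Lemma piece_sym A T : symmetric (piece A T).
Proof.
suff H x y : piece A T x y -> piece A T y x by move=> x y; apply/idP/idP; apply: H.
move=> /existsP[t /and3P[exy xt yx]]; apply/existsP; exists t.
by rewrite es exy (subsetP (extracted_comp xt)) //= (comp_eq yx) mem_comp.
Qed.

Lemma piece_card A T x : #|connect (piece A T) x| <= K.+1.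
Proof.
have [xR|/removed[t xt]] := boolP (x \in remain A T).
  apply: (@leq_trans 1) => //; rewrite -(cards1 x); apply: subset_leq_card.
  apply/subsetP => y xy.
  apply: (connect_closed (D := mem [set x])) xy; rewrite ?inE // => z w.
  rewrite inE => /eqP-> /existsP[t /and3P[_]].
  move: xR => /(subsetP (remain_mono A (ltn_ord t))); rewrite inE.
  by move=> /andP[/negPf->].
apply: (@leq_trans #|component (remain A t :&: A t) x|); last first.
  by move: xt; rewrite inE => /and3P[_ + _] => /leq_trans -> //.
apply: subset_leq_card; apply/subsetP => y xy.
apply: connect_closed xy; last exact: mem_comp.
move=> z w zx /existsP[t' /and3P[_ zt' wz]].
have zt := subsetP (extracted_comp xt) _ zx.
by rewrite -(comp_eq zx) (extracted_inj zt zt').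
Qed.

Lemma cut_complete A T x y : e x y -> ~~ piece A T x y ->
  ((x, y) \in cut A T) || ((y, x) \in cut A T).
Proof.
move=> exy npc.
have [xR|/removed[t xt]] := boolP (x \in remain A T); first by rewrite !inE xR exy.
have [yR|/removed[t' yt]] := boolP (y \in remain A T).
  by rewrite ![(y, x) \in _]inE yR es exy /= orbT.
(* With [a] extracted no later than [b], the vertex [b] still survives in round [u], and it lies
   outside the component of [a] because the edge is in no piece. *)
have H (a b : V) (u u' : 'I_T) : u <= u' -> e a b ->
   a \in extracted (remain A u) (A u) -> b \in extracted (remain A u') (A u') ->
   ~~ piece A T a b -> (a, b) \in cut A T.
  move=> uu' eab au bu' nab; rewrite in_setU; apply/orP; right.
  apply/bigcupP; exists u => //; rewrite inE /= au eab /=.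
  rewrite (subsetP (remain_mono A uu') _ (subsetP (extracted_sub _ _) _ bu')) /=.
  by apply: contra nab => bC; apply/existsP; exists u; rewrite eab au.
case: (leqP t t') => tt'; first by rewrite (H x y t t').
by rewrite (H y x t' t) ?orbT // 1?ltnW // 1?es // piece_sym.
Qed.

(** A leftover vertex costs at most [d] edges. For an extracted component, [tight] bounds [s] times
    the boundary by its size, and these sizes add up to at most [#|V|]. *)
Lemma card_cut d A T : (forall x, #|e x| <= d) ->
  s * #|cut A T| <= s * d * #|remain A T| + #|V|.
Proof.
move=> deg; apply: (@leq_trans (s * (d * #|remain A T| + \sum_(t < T)
   #|[set p : V * V | (p.1 \in extracted (remain A t) (A t)) &&
    [&& e p.1 p.2, p.2 \in remain A t & p.2 \notin component (remain A t :&: A t) p.1]]|))).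
  rewrite leq_mul2l; apply/orP; right.
  apply: leq_trans (leq_card_setU _ _) _; apply: leq_add.
    by apply: card_pairs_le => x; rewrite cardsE; apply: deg.
  elim/big_rec2: _ => [|t n B _ H]; first by rewrite cards0.
  by apply: leq_trans (leq_card_setU _ _) _; rewrite leq_add2l.
rewrite mulnDr mulnA leq_add2l big_distrr /=.
apply: leq_trans (_ : \sum_(t < T) #|extracted (remain A t) (A t)| <= _); last first.
  by rewrite -(card_extracted A T) leq_addr.
apply: leq_sum => t _.
set U := remain A t; set X := U :&: A t.
rewrite (card_pairs (extracted U (A t))
   (fun x y => [&& e x y, y \in U & y \notin component X x])).
rewrite big_distrr /= -sum1_card.
apply: (@class_leq_sum _ (component X) _ (fun x => s * out U (component X x) x)).
- exact: mem_comp.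
- by move=> x y; apply: comp_eq.
- by move=> x; apply: extracted_comp.
move=> x; rewrite inE => /and3P[_ _ Ct].
rewrite sum1_card -big_distrr /=; apply: leq_trans Ct.
by rewrite leq_mul2l; apply/orP; right; apply: leq_sum => y /comp_eq ->.
Qed.

(** A component of [U :\: Z] that is not good is smaller than [s] times its boundary. A boundary
    edge can only end in [Z], since otherwise it would stay inside the component, so there are at
    most [d * #|Z|] of them altogether. The summand 1 accounts for [Z] itself. *)
Lemma card_bad d U Z : (forall x, #|e x| <= d) ->
  #|U :\: good U Z| <= (1 + s * d) * #|Z|.
Proof.
move=> deg; pose B := [set u in U :\: Z | u \notin good U Z].
have sub : U :\: good U Z \subset Z :|: B.
  apply/subsetP => u uU; rewrite in_setU; have [//|uZ /=] := boolP (u \in Z).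
  by move: uU; rewrite !in_setD [u \in B]inE in_setD uZ => /andP[-> ->].
apply: leq_trans (subset_leq_card sub) _; apply: leq_trans (leq_card_setU _ _) _.
rewrite mulnDl mul1n leq_add2l.
pose C := component (U :\: Z).
apply: (@leq_trans (\sum_(x in B) s * out U (C x) x)).
  rewrite -sum1_card; apply: (@class_leq_sum _ C).
  - exact: mem_comp.
  - by move=> x y; apply: comp_eq.
  - move=> x; rewrite inE => /andP[xX xg]; apply/subsetP => y yx; rewrite inE.
    rewrite (subsetP (comp_sub xX)) //=; apply: contra xg.
    by rewrite [y \in _]inE [x \in _]inE xX (comp_eq yx) => /andP[_ ->].
  move=> x; rewrite inE => /andP[xX]; rewrite inE xX /= -ltnNge => H.
  rewrite sum1_card; apply: (leq_trans (ltnW H)); rewrite -big_distrr leq_mul2l.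
  by apply/orP; right; apply: leq_sum => y yx; rewrite /C (comp_eq yx).
rewrite -big_distrr -mulnA leq_mul2l; apply/orP; right.
rewrite -(@card_pairs _ _ B (fun x y => [&& e x y, y \in U & y \notin C x])).
apply: leq_trans (@card_pairs_le V V d Z e _); last by move=> x; rewrite cardsE; apply: deg.
rewrite -(card_imset _ (f := fun p : V * V => (p.2, p.1))); last by move=> [a b] [a' b'] [-> ->].
apply: subset_leq_card; apply/subsetP => p /imsetP[[x y]].
rewrite inE [x \in B]inE in_setD /=.
move=> /and4P[/andP[/andP[xZ xU] _] exy yU yC] ->.
rewrite inE /= es exy andbT; apply: contraR yC => yZ.
by rewrite inE connect1 // /relX exy !inE xZ xU yZ yU.
Qed.

(** The component lies within distance [K - 1] of [u], so its neighbours lie in the [K]-ball, where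
    [A] contains nothing else. Hence it is also the component of [u] in [U :&: A]. *)
Lemma good_extracted U Z (A : {set V}) u : u \in good U Z -> #|component (U :\: Z) u| <= K ->
  (forall x, x \in nball e K u -> (x \in A) = (x \in component (U :\: Z) u)) ->
  u \in extracted U A.
Proof.
rewrite inE => /andP[uU ug] cK HA; set C := component _ _ in ug cK HA.
have CU : C \subset U by apply: subset_trans (comp_sub uU) (subsetDl _ _).
have Cb x : x \in C -> x \in nball e K.-1 u.
  move=> xC; have: x \in nball (relX e (U :\: Z)) K.-1 u.
    by apply: connect_nball; [move: cK; rewrite /C /component cardsE | move: xC; rewrite inE].
  by apply: (subsetP (nball_subrel _ _ _)) => a b /and3P[].
have K0 : 0 < K by apply: leq_trans cK; apply/card_gt0P; exists u; apply: mem_comp.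
have Cb' x : x \in C -> x \in nball e K u.
  by move=> /Cb; apply: (subsetP (nball_sub _ _ (leq_pred K))).
have CA x : x \in C -> x \in A by move=> xC; rewrite HA // Cb'.
have CE : component (U :&: A) u = C.
  apply/setP => x; apply/idP/idP; last first.
    rewrite inE => ux.
    have D := @connect_closed _ (relX e (U :\: Z))
      [pred z | (z \in C) && connect (relX e (U :&: A)) u z] u x.
    have {D} : x \in [pred z | (z \in C) && connect (relX e (U :&: A)) u z].
      apply: D ux; last by rewrite inE /= mem_comp connect0.
      move=> z w /andP[zC uz] zw.
      have wC : w \in C.
        by move: zC; rewrite !inE => /connect_trans; apply; apply: connect1.
      rewrite inE /= wC; apply: connect_trans uz (connect1 _).
      by rewrite /relX !inE !CA // !(subsetP CU) // !andbT; case/and3P: zw.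
    by rewrite !inE => /andP[].
  rewrite inE.
  apply: connect_closed; last exact: mem_comp.
  move=> a b aC /and3P[eab _]; rewrite inE => /andP[bU bA].
  by rewrite -HA // -(prednK K0); apply: nball_step eab; apply: Cb.
by rewrite inE CE /tight cK ug !inE (subsetP CU) ?CA ?mem_comp.
Qed.

End Partition.
End Rounds.

(** * Locality of the extraction procedure *)

Section RoundsLocality.
Local Open Scope nat_scope.

Section Transport.
Variables (V W : finType) (e : rel V) (e' : rel W) (s : V -> W) (K m : nat).
Hypothesis s_bij : bijective s.

Lemma comp_le_local k v (X : {set V}) (Y : {set W}) : loceq e e' s k v ->
  (forall x, x \in nball e k.+1 v -> (s x \in Y) = (x \in X)) ->
  (#|component e' Y (s v)| <= k) = (#|component e X v| <= k).
Proof.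
by move=> L XY; rewrite !cardsE; apply: loceq_connect_le => //; apply: loceq_relX.
Qed.

Lemma comp_local k v (X : {set V}) (Y : {set W}) : loceq e e' s k v ->
  (forall x, x \in nball e k.+1 v -> (s x \in Y) = (x \in X)) ->
  #|component e X v| <= k -> component e' Y (s v) = s @: component e X v.
Proof.
move=> L XY; rewrite cardsE => ck; have [s' sK s'K] := s_bij.
apply/setP => z; rewrite -(s'K z) (mem_imset _ _ (can_inj sK)) !inE.
exact: (loceq_connect s_bij _ (loceq_relX L XY)).
Qed.

(** A component of at most [K] vertices, or the fact that it is larger, is visible within the
    [K]-ball. Its boundary edges reach one step further. *)
Lemma extracted_local v (U A : {set V}) (U' A' : {set W}) : loceq e e' s K.+1 v ->
  (forall x, x \in nball e K.+1 v -> (s x \in U') = (x \in U)) ->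
  (forall x, x \in nball e K.+1 v -> (s x \in A') = (x \in A)) ->
  (s v \in extracted e' K m U' A') = (v \in extracted e K m U A).
Proof.
move=> L hU hA; have [s' sK s'K] := s_bij; have sI := can_inj sK.
have hX x : x \in nball e K.+1 v -> (s x \in U' :&: A') = (x \in U :&: A).
  by move=> xv; rewrite !inE hU ?hA.
rewrite inE [RHS]inE hX ?nball_self // /tight.
have LK := loceq_le L (leqnSn K).
rewrite (comp_le_local LK hX).
have [cK|] := boolP (#|component e (U :&: A) v| <= K) => //=.
rewrite (comp_local LK hX cK) card_imset //; congr (_ && (_ * _ <= _)).
rewrite big_imset /=; last by move=> a b _ _; apply: sI.
apply: eq_bigr => x xC.
have xb : x \in nball e K v.
  have: x \in nball (relX e (U :&: A)) K.-1 v.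
    apply: connect_nball; first by move: cK; rewrite cardsE.
    by move: xC; rewrite inE.
  move=> /(subsetP (nball_sub _ _ (leq_pred K))).
  by apply: (subsetP (nball_subrel _ _ _)) => a b /and3P[].
rewrite /out -(card_imset _ sI); apply: eq_card => z; rewrite inE -(s'K z).
rewrite !(mem_imset _ _ sI) [RHS]inE LK //.
by have [exz|//] := boolP (e x (s' z)); rewrite hU //; apply: nball_step exz.
Qed.

(** Each round looks [K.+1] further than the previous one. *)
Lemma remain_local v (A : nat -> {set V}) (A' : nat -> {set W}) t : loceq e e' s (t * K.+1) v ->
  (forall u x, u < t -> x \in nball e (t * K.+1) v -> (s x \in A' u) = (x \in A u)) ->
  (s v \in remain e' K m A' t) = (v \in remain e K m A t).
Proof.
elim: t v => [|t IH] v L hA; first by rewrite !inE.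
have IHx x : x \in nball e K.+1 v ->
    (s x \in remain e' K m A' t) = (x \in remain e K m A t).
  move=> xv; apply: IH => [|u y ut yx]; first by apply: loceq_sub xv; rewrite -mulSn.
  by apply: hA; [apply: ltnW | rewrite mulSn; apply: nball_trans yx].
rewrite /= !in_setD IHx ?nball_self //; congr (~~ _ && _).
apply: extracted_local => // [|x xv]; first by apply: loceq_le L _; rewrite mulSn leq_addr.
by apply: hA => //; apply: (subsetP (nball_sub _ _ _)) xv; rewrite mulSn leq_addr.
Qed.

Lemma piece_local v y (A : nat -> {set V}) (A' : nat -> {set W}) T : loceq e e' s (T.+1 * K.+1) v ->
  (forall u x, u < T -> x \in nball e (T.+1 * K.+1) v -> (s x \in A' u) = (x \in A u)) ->
  piece e' K m A' T (s v) (s y) = piece e K m A T v y.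
Proof.
move=> L hA; have [s' sK s'K] := s_bij; have sI := can_inj sK.
have LK : loceq e e' s K.+1 v by apply: loceq_le L _; rewrite mulSn leq_addr.
have KT : K.+1 <= T.+1 * K.+1 by rewrite mulSn leq_addr.
apply: eq_existsb => t.
have hR x : x \in nball e K.+1 v ->
    (s x \in remain e' K m A' t) = (x \in remain e K m A t).
  move=> xv; have tT : K.+1 + t * K.+1 <= T.+1 * K.+1.
    by rewrite -mulSn leq_mul2r ltnS ltnW ?orbT.
  apply: remain_local => [|u z ut zx].
    by apply: loceq_sub xv; apply: loceq_le L _.
  apply: hA; first exact: ltn_trans (ltn_ord t).
  by apply: (subsetP (nball_sub _ _ tT)); apply: nball_trans zx.
have hAt x : x \in nball e K.+1 v -> (s x \in A' t) = (x \in A t).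
  by move=> xv; apply: hA => //; apply: (subsetP (nball_sub _ _ KT)) xv.
rewrite L ?nball_self // (extracted_local LK hR hAt).
have [|//] := boolP (v \in extracted e K m (remain e K m A t) (A t)).
rewrite inE => /and3P[_ cK _] /=; congr (_ && _).
rewrite (comp_local (loceq_le LK (leqnSn K)) _ cK) ?mem_imset //.
by move=> x xv; rewrite !inE hR ?hAt.
Qed.

End Transport.

(** A label holds one coin for each of the [T] rounds. Beyond these rounds the active set is empty
    by default. *)
Definition act (V : finType) (T : nat) (lam : {ffun V -> {ffun 'I_T -> bool}}) (t : nat) :
    {set V} :=
  [set v | if insub t is Some i then lam v i else false].

(** [None] stands for being left over, [Some c] for lying in a piece with code [c]. *)
Definition local_stat (V : finType) (e : rel V) (K m T : nat) (c : option (code_type K))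
    (lam : {ffun V -> {ffun 'I_T -> bool}}) (v : V) : bool :=
  if c is Some c' then hascode (piece e K m (act lam) T) c' v
  else v \in remain e K m (act lam) T.

(** The first summand decides the piece edges at one vertex. The second allows for the other
    vertices of the piece, which has at most [K.+1] of them. *)
Definition stat_radius (K T : nat) : nat := T.+1 * K.+1 + K.+1.

Lemma local_stat_local (V W : finType) (e : rel V) (e' : rel W) s K m T
    (c : option (code_type K)) (lam : {ffun V -> {ffun 'I_T -> bool}})
    (lam' : {ffun W -> {ffun 'I_T -> bool}}) v :
  symmetric e -> bijective s -> loceq e e' s (stat_radius K T) v ->
  (forall x, x \in nball e (stat_radius K T) v -> lam' (s x) = lam x) ->
  local_stat e' m c lam' (s v) = local_stat e m c lam v.
Proof.
move=> es sb L hl.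
have hA u x : x \in nball e (stat_radius K T) v -> (s x \in act lam' u) = (x \in act lam u).
  by move=> xv; rewrite !inE; case: insub => // i; rewrite hl.
case: c => [c|] /=; last first.
  have le : T * K.+1 <= stat_radius K T by rewrite /stat_radius mulSn -addnA addnCA leq_addr.
  apply: remain_local => // [|u x _ xv]; first exact: loceq_le L _.
  by apply: hA; apply: (subsetP (nball_sub _ _ le)) xv.
apply: (@loceq_hascode _ _ _ _ _ _ K.+1) => //; last exact: piece_card.
move=> x y /(subsetP (nball_subrel _ _ (@piece_sub _ _ _ _ _ _))) xv.
have L' : loceq e e' s (K.+1 + T.+1 * K.+1) v by rewrite addnC.
apply: piece_local => // [|u z uT zx]; first exact: loceq_sub L' xv.
by apply: hA; rewrite /stat_radius addnC; apply: nball_trans zx.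
Qed.

End RoundsLocality.

(** * The expected number of leftover vertices *)

Section Leftover.
Local Open Scope nat_scope.

Variables (V : finType) (e : rel V) (K m T : nat).
Hypothesis es : symmetric e.
Notation labels := {ffun V -> {ffun 'I_T -> bool}}.
Notation remain := (remain e K m).
Notation extracted := (extracted e K m).

Definition flip (t : 'I_T) (B : {set V}) (lam : labels) : labels :=
  [ffun v => [ffun i => lam v i (+) ((i == t) && (v \in B))]].

Lemma flipK t B : involutive (flip t B).
Proof. by move=> lam; apply/ffunP => v; apply/ffunP => i; rewrite !ffunE addbK. Qed.

Lemma act_flip t B lam (u : 'I_T) x :
  (x \in act (flip t B lam) u) = (x \in act lam u) (+) ((u == t) && (x \in B)).
Proof. by rewrite !inE valK !ffunE. Qed.

Lemma eq_remain A A' t : (forall u, u < t -> A u = A' u) -> remain A t = remain A' t.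
Proof.
elim: t => //= t IH H; rewrite IH => [|u ut]; last by apply: H; apply: ltnW.
by rewrite H.
Qed.

(* Given the earlier rounds, flipping the round-t labels inside the K-ball around u
   in one of its at most 2 ^ N ways extracts u as soon as u is good. *)
Lemma good_count N Z (t : 'I_T) u : #|nball e K u| <= N ->
  (forall U, u \in U :\: Z -> #|component e (U :\: Z) u| <= K) ->
  #|[set lam : labels | u \in good e m (remain (act lam) t) Z]| <=
  2 ^ N * #|[set lam : labels | u \in extracted (remain (act lam) t) (act lam t)]|.
Proof.
move=> bN cK; set E := [set lam | u \in extracted _ _].
apply: (@leq_trans (\sum_(B in powerset (nball e K u)) #|flip t B @: E|)); last first.
  rewrite (eq_bigr (fun _ => #|E|)) => [|B _]; last first.
    by rewrite card_imset //; apply: inv_inj; apply: flipK.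
  by rewrite sum_nat_const card_powerset leq_mul2r leq_exp2l ?bN ?orbT.
apply: (@leq_trans #|\bigcup_(B in powerset (nball e K u)) (flip t B @: E)|); last first.
  elim/big_rec2: _ => [|B n A _ H]; first by rewrite cards0.
  by apply: leq_trans (leq_card_setU _ _) _; rewrite leq_add2l.
apply: subset_leq_card; apply/subsetP => lam; rewrite inE => ug.
set U := remain (act lam) t in ug; pose C := component e (U :\: Z) u.
have uU : u \in U :\: Z by move: ug; rewrite inE => /andP[].
(* Flipping exactly where the active set and [C] disagree makes them agree on the ball. *)
pose B := [set v in nball e K u | (v \in act lam t) (+) (v \in C)].
apply/bigcupP; exists B; first by rewrite inE; apply/subsetP => v; rewrite inE => /andP[].
apply/imsetP; exists (flip t B lam); last by rewrite flipK.
rewrite inE (@eq_remain _ (act lam)); last first.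
  move=> i it; have iT := ltn_trans it (ltn_ord t).
  apply/setP => x; rewrite (act_flip t B lam (Ordinal iT)) -val_eqE /=.
  by rewrite ltn_eqF // addbF.
apply: good_extracted ug (cK _ uU) _ => // x xv.
by rewrite act_flip eqxx [x \in B]inE xv /= addbA addbb.
Qed.

(** The survivors decrease, so [T] times the final leftover is at most the sum over the rounds. In
    each round the survivors that are not good are bounded by [card_bad], and the good ones are on
    average at most [2 ^ N] times as many as those extracted. The extracted vertices of all rounds
    together number at most [#|V|]. *)
Lemma sum_leftover d Z : (forall x, #|e x| <= d) ->
  (forall x, #|connect (relX e (~: Z)) x| <= K) ->
  \sum_(lam : labels) T * #|remain (act lam) T| <=
  #|{: labels}| * (2 ^ (d.+1 ^ K) * #|V| + T * ((1 + m * d) * #|Z|)).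
Proof.
move=> deg hZ; set N := d.+1 ^ K; set b := (1 + m * d) * #|Z|.
have cK u U : u \in U :\: Z -> #|component e (U :\: Z) u| <= K.
  move=> _; apply: leq_trans (hZ u); rewrite -[X in _ <= X]cardsE.
  apply: subset_leq_card; apply/subsetP => y; rewrite !inE.
  apply: connect_sub => a c /and3P[eac]; rewrite !inE => /andP[aZ _] /andP[cZ _].
  by apply: connect1; rewrite /relX eac !inE aZ cZ.
pose g (lam : labels) (t : 'I_T) := #|good e m (remain (act lam) t) Z|.
pose x (lam : labels) (t : 'I_T) := #|extracted (remain (act lam) t) (act lam t)|.
apply: (@leq_trans (\sum_(lam : labels) \sum_(t < T) (g lam t + b))).
  apply: leq_sum => lam _; rewrite -[X in X * _]card_ord -sum_nat_const.
  apply: leq_sum => t _; set U := remain (act lam) t.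
  apply: leq_trans (_ : #|U| <= _).
    by apply: subset_leq_card; apply: remain_mono; apply: ltnW.
  rewrite -(cardsID (good e m U Z) U); apply: leq_add.
    by apply: subset_leq_card; apply: subsetIr.
  exact: card_bad.
have -> : \sum_(lam : labels) \sum_(t < T) (g lam t + b) =
    \sum_(t < T) \sum_(lam : labels) g lam t + #|{: labels}| * (T * b).
  rewrite [in RHS]exchange_big -sum_nat_const -big_split /=; apply: eq_bigr => lam _.
  by rewrite big_split /= sum_nat_const card_ord.
rewrite mulnDr leq_add2r.
have card_sum (P : labels -> V -> bool) : \sum_(lam : labels) #|[set u | P lam u]| =
    \sum_(u : V) #|[set lam | P lam u]|.
  rewrite (eq_bigr (fun lam => \sum_(u : V) P lam u)) => [|lam _]; last first.
    by rewrite -sum1dep_card big_mkcond; apply: eq_bigr => u _; case: (P lam u).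
  rewrite exchange_big; apply: eq_bigr => u _.
  by rewrite -sum1dep_card [RHS]big_mkcond; apply: eq_bigr => lam _; case: (P lam u).
apply: (@leq_trans (\sum_(t < T) 2 ^ N * \sum_(lam : labels) x lam t)).
  apply: leq_sum => t _.
  have -> : \sum_(lam : labels) g lam t =
      \sum_(u : V) #|[set lam : labels | u \in good e m (remain (act lam) t) Z]|.
    rewrite -card_sum; apply: eq_bigr => lam _.
    by apply: eq_card => u; rewrite [in RHS]inE.
  have -> : \sum_(lam : labels) x lam t = \sum_(u : V)
      #|[set lam : labels | u \in extracted (remain (act lam) t) (act lam t)]|.
    rewrite -card_sum; apply: eq_bigr => lam _.
    by apply: eq_card => u; rewrite [in RHS]inE.
  rewrite big_distrr /=; apply: leq_sum => u _; apply: good_count => // [|U].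
    exact: card_nball.
  exact: cK.
rewrite -big_distrr /= exchange_big mulnCA leq_mul2l; apply/orP; right.
rewrite -sum_nat_const; apply: leq_sum => lam _.
by rewrite -(card_extracted e K m (act lam) T) leq_addr.
Qed.

End Leftover.

(** * A second moment bound for local statistics of random labellings *)

Section Concentration.
Variables (R : realFieldType) (V L : finType).
Notation labels := {ffun V -> L}.
Notation M := (#|{: labels}|%:R : R).

(* Swapping two independent labellings off A is an involution on pairs. *)
Lemma sum_indep (A : {set V}) (f g : labels -> R) :
  (forall a b : labels, {in A, a =1 b} -> f a = f b) ->
  (forall a b : labels, {in ~: A, a =1 b} -> g a = g b) ->
  (\sum_a f a) * (\sum_a g a) = M * \sum_a f a * g a.
Proof.
move=> fA gA.
pose mix (p : labels * labels) : labels := [ffun v => if v \in A then p.1 v else p.2 v].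
pose sw (p : labels * labels) := (mix p, mix (p.2, p.1)).
have swK : involutive sw.
  by case=> a b; rewrite /sw /=; congr pair; apply/ffunP => v; rewrite !ffunE /= ?ffunE;
    case: (v \in A).
rewrite big_distrl /=.
under eq_bigr do rewrite big_distrr /=.
rewrite pair_bigA /= (eq_bigr (fun p => f (sw p).1 * g (sw p).1)); last first.
  move=> [a b] _ /=; congr (_ * _); [apply: fA|apply: gA] => v vA; rewrite !ffunE /=.
    by rewrite vA.
  by move: vA; rewrite inE => /negPf ->.
rewrite -(reindex_inj (inv_inj swK) (P := xpredT) (F := fun p => f p.1 * g p.1)) /=.
rewrite -(pair_bigA _ (fun a _ => f a * g a)) /= mulr_sumr; apply: eq_bigr => a _.
by rewrite sumr_const mulr_natl.
Qed.

(** [X c a v] depends only on the labels in [N v], so the variance of a count involves only pairs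
    with meeting neighbourhoods, at most [#|V| * D] of them. Some labelling does no worse than
    average for the squared deviations summed over [c], hence serves all [c] at once. *)
Lemma concentration (C : finType) (X : C -> labels -> V -> bool) (N : V -> {set V})
    (D : nat) : (0 < #|L|)%N ->
  (forall c v (a b : labels), {in N v, a =1 b} -> X c a v = X c b v) ->
  (forall v, (#|[set w | ~~ [disjoint N v & N w]]| <= D)%N) ->
  exists lam : labels,
    \sum_c (#|[set v | X c lam v]|%:R - (\sum_a #|[set v | X c a v]|%:R) / M) ^+ 2
      <= (#|C| * (#|V| * D))%:R.
Proof.
move=> L0 XN ND.
have M0 : 0 < M by rewrite ltr0n card_ffun expn_gt0 L0.
pose S c a : R := #|[set v | X c a v]|%:R.
pose x c v a : R := (X c a v)%:R.
have SE c a : S c a = \sum_v x c v a.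
  rewrite /S -sum1dep_card natr_sum big_mkcond; apply: eq_bigr => v _.
  by rewrite /x; case: (X c a v).
have var c : \sum_a (S c a - (\sum_b S c b) / M) ^+ 2 <= M * (#|V| * D)%:R.
  set m := (_ / M).
  have mE : \sum_b S c b = M * m by rewrite /m mulrCA divff ?mulr1 // gt_eqF.
  have -> : \sum_a (S c a - m) ^+ 2 = \sum_a S c a ^+ 2 - M * m ^+ 2.
    have -> : \sum_a (S c a - m) ^+ 2 =
        \sum_a S c a ^+ 2 - (m *+ 2) * (\sum_a S c a) + M * m ^+ 2.
      under eq_bigr do rewrite sqrrB.
      rewrite big_split /= sumrB sumr_const mulr_natl; congr (_ - _ + _).
      by rewrite mulr_sumr; apply: eq_bigr => a _; ring.
    by rewrite mE; ring.
  rewrite -(ler_pM2l M0) mulrBr.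
  have -> : M * (M * m ^+ 2) = (\sum_a S c a) ^+ 2 by rewrite mE; ring.
  (* The variance, scaled by the square of [M], as a double sum of covariances. *)
  have -> : M * (\sum_a S c a ^+ 2) - (\sum_a S c a) ^+ 2 =
     \sum_v \sum_w (M * (\sum_a x c v a * x c w a) - (\sum_a x c v a) * (\sum_a x c w a)).
    under [RHS]eq_bigr do rewrite sumrB.
    rewrite sumrB; congr (_ - _).
      under [RHS]eq_bigr do rewrite -mulr_sumr.
      rewrite -mulr_sumr; congr (_ * _).
      under [RHS]eq_bigr do rewrite exchange_big.
      rewrite [RHS]exchange_big /=; apply: eq_bigr => a _.
      by rewrite SE expr2 big_distrl /=; apply: eq_bigr => v _; rewrite big_distrr.
    rewrite (eq_bigr _ (fun a _ => SE c a)) exchange_big expr2 big_distrl /=.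
    by apply: eq_bigr => v _; rewrite big_distrr.
  apply: (@le_trans _ _ (\sum_(v : V) D%:R * (M * M))); last first.
    by rewrite sumr_const -mulr_natl !natrM; rewrite le_eqVlt; apply/orP; left; apply/eqP; ring.
  apply: ler_sum => v _.
  apply: (@le_trans _ _ (\sum_(w | ~~ [disjoint N v & N w]) M * M)); last first.
    rewrite sumr_const -[leLHS]mulr_natl ler_pM2r ?mulr_gt0 //.
    by rewrite ler_nat; apply: leq_trans (ND v); rewrite cardsE.
  rewrite big_mkcond /= big_mkcond [X in _ <= X]big_mkcond /=; apply: ler_sum => w _.
  case: ifPn => [dvw|]; last first.
    rewrite negbK => dvw.
    rewrite -(sum_indep (A := N v) (f := x c v)) ?subrr //.
      by move=> a b ab; rewrite /x (XN _ _ _ _ ab).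
    move=> a b ab; rewrite /x (XN _ _ a b) // => z zw; apply: ab.
    by rewrite inE; apply: contraL zw => zv; rewrite (disjointFr dvw).
  have x0 u a : 0 <= x c u a by rewrite /x ler0n.
  have x1 u a : x c u a <= 1 by rewrite /x; case: (X _ _ _).
  apply: (@le_trans _ _ (M * \sum_a x c v a * x c w a)).
    by rewrite gerBl mulr_ge0 // sumr_ge0.
  rewrite ler_pM2l //; apply: (@le_trans _ _ (\sum_(a : labels) 1)).
    by apply: ler_sum => a _; rewrite mulr_ile1.
  by rewrite sumr_const.
case: (pselect (exists lam : labels, \sum_c (S c lam - (\sum_a S c a) / M) ^+ 2
      <= (#|C| * (#|V| * D))%:R)) => // H; exfalso.
have : \sum_(a : labels) \sum_c (S c a - (\sum_b S c b) / M) ^+ 2 <=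
       \sum_(a : labels) (#|C| * (#|V| * D))%:R.
  rewrite exchange_big /=; apply: le_trans (ler_sum _ (fun c _ => var c)) _.
  rewrite !sumr_const -[leLHS]mulr_natl -[leRHS]mulr_natl !natrM le_eqVlt; apply/orP; left; apply/eqP; ring.
apply/negP; rewrite -ltNge.
have [l _] : exists l : labels, true.
  have /card_gt0P[l _] : (0 < #|{: labels}|)%N by rewrite -(ltr0n R).
  by exists l.
apply: ltr_sum => [|a _]; first by apply/hasP; exists l; rewrite ?mem_index_enum.
by rewrite ltNge; apply/negP => Ha; apply: H; exists a.
Qed.

End Concentration.

(** * Rooted isomorphism types of balls *)

Section Types.
Local Open Scope nat_scope.

Lemma nball_path (V : finType) (e : rel V) k v y : y \in nball e k v ->
  exists2 p, path e v p & last v p = y /\ size p <= k.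
Proof.
elim: k y => [|k IH] y; first by rewrite inE => /eqP->; exists [::].
case/nballSP => [/IH[p pp [lp sp]]|[x /IH[p pp [lp sp]] exy]].
  by exists p => //; split=> //; apply: leqW.
by exists (rcons p y); rewrite ?rcons_path ?pp ?lp ?exy // last_rcons size_rcons.
Qed.

Lemma dist_leE (G : sgraph) r (x y : G) : dist_le r x y = (y \in nball (@adj G) r x).
Proof.
apply/idP/idP => [/existsP[k /existsP[s /andP[ps /eqP <-]]]|/nball_path[p pp [lp sp]]].
  have := path_nball ps; apply: (subsetP (nball_sub _ _ _)).
  by rewrite size_tuple -ltnS.
have sp' : size p < r.+1 by rewrite ltnS.
apply/existsP; exists (Ordinal sp'); apply/existsP; exists (in_tuple p).
by rewrite /= pp lp eqxx.
Qed.

Lemma riso_sym A B : riso A B -> riso B A.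
Proof.
move=> [f [[g fK gK] fr fe]]; exists g; split; first by exists f.
  by rewrite -fr fK.
by move=> x y; rewrite -fe !gK.
Qed.

Lemma riso_trans A B C : riso A B -> riso B C -> riso A C.
Proof.
move=> [f [fb fr fe]] [g [gb gr ge]]; exists (g \o f); split=> /=.
- exact: bij_comp.
- by rewrite fr.
- by move=> x y; rewrite ge fe.
Qed.

Lemma in_U_rball d r (G : sgraph) (v : G) : max_degree_le d G -> in_U d r (rball r v).
Proof.
move=> dG; split=> [x|[y yb]].
  rewrite -(card_imset _ val_inj); apply: leq_trans (dG (val x)).
  by apply: subset_leq_card; apply/subsetP => z /imsetP[y xy ->].
have [p pp [lp sp]] := nball_path (etrans (esym (dist_leE _ _ _)) yb).
rewrite dist_leE; move: yb; rewrite -lp => yb {lp}.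
(* Distances have to be realised inside the ball: a walk of length at most [r] from [v] never leaves
   it, as the induction on [j] shows. *)
suff H : forall j, j <= r -> forall z (zb : dist_le r v z), z \in nball (@adj G) j v ->
    exist _ z zb \in nball (@adj (rball r v)) j (rg_root (rball r v)).
  by apply: H => //; rewrite -dist_leE.
elim=> [|j IH] jr z zb.
  rewrite !inE => /eqP zv; apply/eqP; exact: val_inj.
case/nballSP => [zj|[x xj xz]].
  by apply/nballSP; left; apply: IH => //; apply: ltnW.
have xb : dist_le r v x.
  by rewrite dist_leE; apply: (subsetP (nball_sub _ _ (ltnW jr))) xj.
by apply: nball_step (IH (ltnW jr) x xb xj) _.
Qed.

(** The isomorphism of balls is extended arbitrarily to a bijection. One unit of radius is lost: an
    [r]-ball shows only edges between its own vertices, so it shows all edges only at vertices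
    within distance [r.-1]. *)
Lemma riso_loceq (G H : sgraph) r (v : G) (w : H) : #|G| = #|H| -> 0 < r ->
  riso (rball r v) (rball r w) ->
  exists2 s : G -> H, bijective s & s v = w /\ loceq (@adj G) (@adj H) s r.-1 v.
Proof.
move=> cGH r0 [f [[f' fK f'K] fr fe]].
pose D := [set x : G | dist_le r v x].
pose h (x : G) : H := if insub x is Some u then val (f u : {y : H | dist_le r w y}) else w.
have hE x (xb : dist_le r v x) : h x = val (f (exist _ x xb)).
  by rewrite /h insubT.
have hi : {in D &, injective h}.
  move=> x y; rewrite !inE => xb yb; rewrite !hE => /val_inj /(can_inj fK) [].
  by [].
have [s sb sh] := extend_inj cGH hi.
have sI := bij_inj sb.
have sE x (xb : dist_le r v x) : s x = val (f (exist _ x xb)).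
  by rewrite sh ?inE // hE.
have sadj x y : dist_le r v x -> dist_le r v y -> adj (s x) (s y) = adj x y.
  by move=> xb yb; rewrite !sE; apply: (fe (exist _ x xb) (exist _ y yb)).
have sv : s v = w by rewrite (sE _ (dist_le_refl r v)) -[exist _ _ _]/(rg_root (rball r v)) fr.
have snb j x : j <= r -> x \in nball (@adj G) j v -> s x \in nball (@adj H) j w.
  elim: j x => [|j IH] x jr; first by rewrite !inE => /eqP->; rewrite sv.
  move=> xj; have xb : dist_le r v x.
    by rewrite dist_leE; apply: (subsetP (nball_sub _ _ jr)) xj.
  case/nballSP: xj => [xj|[z zj zx]]; first by apply/nballSP; left; apply: IH => //; apply: ltnW.
  apply: nball_step (IH _ (ltnW jr) zj) _; rewrite sadj //.
  by rewrite dist_leE; apply: (subsetP (nball_sub _ _ (ltnW jr))) zj.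
exists s => //; split=> // x y xv.
have xb : dist_le r v x.
  by rewrite dist_leE; apply: (subsetP (nball_sub _ _ (leq_pred r))) xv.
have [yb|yb] := boolP (dist_le r v y); first exact: sadj.
apply/idP/idP => [sxy|xy]; last first.
  by case/negP: yb; rewrite dist_leE -(prednK r0); apply: nball_step xy.
have syb : dist_le r w (s y).
  rewrite dist_leE -(prednK r0); apply: nball_step sxy.
  by apply: snb xv; apply: leq_pred.
case/negP: yb; have := valP (f' (exist _ (s y) syb)).
set u := f' _ => ub; suff -> : y = val u by [].
apply: sI; rewrite (sE _ ub); have -> : exist _ (val u) ub = u :> rball r v by apply: val_inj.
by rewrite /u f'K.
Qed.

Lemma hascode_riso K d r A B (c : code_type K) : in_U d r A -> in_U d r B ->
  hascode (@adj A) c (rg_root A) -> hascode (@adj B) c (rg_root B) -> riso A B.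
Proof.
have conn C : in_U d r C -> forall x, connect (@adj C) (rg_root C) x.
  by move=> [_ H] x; have := H x; rewrite dist_leE => /nball_connect.
move=> /conn cA /conn cB hA hB.
have [h [[hi _ hp] hr]] := hascode_iso hA hB.
have [h' [[hi' _ _] _]] := hascode_iso hB hA.
have {}hi : injective h by move=> x y; apply: hi; [apply: cA | apply: cA].
have {}hi' : injective h' by move=> x y; apply: hi'; [apply: cB | apply: cB].
exists h; split=> // [|x y]; last by apply: hp; apply: cA.
by apply: inj_card_bij => //; apply: leq_card hi'.
Qed.

(** Bounded degree bounds the size of [r]-balls, so finitely many codes describe them all, and
    connected rooted graphs with a common code are isomorphic. *)
Lemma finitely_many_types d alpha r : enumerates_U d alpha -> 0 < r ->
  exists M, forall (G : sgraph) (v : G), max_degree_le d G ->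
  exists i : 'I_M, (alpha i).1 = r /\ riso (rball r v) (alpha i).2.
Proof.
move=> [aU aE] r0; pose N := d.+1 ^ r.
(* An index of radius [r] whose representative has code [c], with default 0 for codes that do not
   occur. *)
pose idx (c : code_type N) : nat :=
  xget 0 [set i | (alpha i).1 = r /\ hascode (@adj _) c (rg_root (alpha i).2)]%classic.
exists (\max_c (idx c)).+1 => G v dG.
set A := rball r v; have AU : in_U d r A by apply: in_U_rball.
have cA : #|connect (@adj A) (rg_root A)| <= N.+1.
  apply: leq_trans (max_card _) _; apply: leqW.
  rewrite -(card_imset _ val_inj); apply: leq_trans (card_nball r v dG).
  apply: subset_leq_card; apply/subsetP => _ /imsetP[y _ ->].
  by rewrite -dist_leE; apply: (valP y).
have [c hc] := hascode_ex cA.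
have [i [[ir iA] _]] := aE r A r0 AU.
have iU : in_U d r (alpha i).2 by have := (aU i).2; rewrite ir.
have hci : hascode (@adj _) c (rg_root (alpha i).2).
  have [f [fb fr fe]] := riso_sym iA.
  by rewrite -fr (@loceq_hascode _ _ _ (@adj A) _ f N.+1).
have [jr jc] : [set i | (alpha i).1 = r /\ hascode (@adj _) c (rg_root (alpha i).2)]%classic
    (idx c) by apply: xgetPex; exists i.
have jM : idx c < (\max_c (idx c)).+1 by rewrite ltnS; apply: leq_bigmax.
exists (Ordinal jM); split=> //=; apply: (hascode_riso AU _ hc jc).
by have := (aU (idx c)).2; rewrite jr.
Qed.

End Types.

(** * Comparing sums of functions that depend only on a type *)

Section SumClose.
Variable R : realType.

(** If a type occurs on both sides, [a] and [b] have one common value on it, which multiplies the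
    difference of the counts. If it is missing on one side, the other sum is at most its count. *)
Lemma type_sum_close (V W T : finType) (typ : V -> T) (typ' : W -> T)
    (a : V -> R) (b : W -> R) :
  (forall v, 0 <= a v <= 1) -> (forall w, 0 <= b w <= 1) ->
  (forall v w, typ v = typ' w -> a v = b w) ->
  `|\sum_v a v - \sum_w b w| <=
  \sum_t `|#|[set v | typ v == t]|%:R - #|[set w | typ' w == t]|%:R|.
Proof.
move=> a01 b01 ab.
rewrite (partition_big typ xpredT) //= [X in _ - X](partition_big typ' xpredT) //=.
rewrite -sumrB; apply: le_trans (ler_norm_sum _ _ _) _; apply: ler_sum => t _.
have cst (X : finType) (f : X -> R) (P : pred X) c : (forall x, P x -> f x = c) ->
    \sum_(x | P x) f x = c * #|[set x | P x]|%:R.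
  by move=> fc; rewrite (eq_bigr _ fc) sumr_const mulr_natr cardsE.
have le1 (X : finType) (f : X -> R) (P : pred X) : (forall x, 0 <= f x <= 1) ->
    0 <= \sum_(x | P x) f x <= #|[set x | P x]|%:R.
  move=> f01; rewrite sumr_ge0 => [|x _]; last by case/andP: (f01 x).
  rewrite -sum1dep_card natr_sum; apply: ler_sum => x _; by case/andP: (f01 x).
have [E|[v]] := set_0Vmem [set v | typ v == t].
  rewrite E cards0 sub0r normrN [X in X - _](_ : _ = 0); last first.
    by apply: big_pred0 => v; have := in_set0 v; rewrite -E inE.
  rewrite sub0r normrN normr_nat; have /andP[? ?] := le1 _ b (fun w => typ' w == t) b01.
  by rewrite ger0_norm.
rewrite inE => /eqP vt.
have [E|[w]] := set_0Vmem [set w | typ' w == t].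
  rewrite E cards0 subr0 [X in _ - X](_ : _ = 0); last first.
    by apply: big_pred0 => w; have := in_set0 w; rewrite -E inE.
  rewrite subr0 normr_nat; have /andP[? ?] := le1 _ a (fun v => typ v == t) a01.
  by rewrite ger0_norm.
rewrite inE => /eqP wt.
rewrite (cst _ a (fun v => typ v == t) (b w)); last by move=> x /eqP xt; apply: ab; rewrite xt wt.
rewrite (cst _ b (fun w => typ' w == t) (b w)); last first.
  by move=> x /eqP xt; rewrite -(ab v w) ?vt ?wt // (ab v x) ?vt ?xt.
rewrite -mulrBr normrM ler_piMl //.
by have /andP[b0 b1] := b01 w; rewrite ger0_norm.
Qed.

End SumClose.

(** * Compactness of the cube and uniform continuity of its coordinates *)

Section CubeMetric.
Variable R : realType.
Local Open Scope classical_set_scope.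

Lemma compact_set_type (T : topologicalType) (A : set T) :
  compact A -> compact [set: A].
Proof.
move=> cA F PF _.
have [p [Ap pF]] := cA (set_val @ F) _ (filterS (fun x _ => set_valP x) filterT).
exists (exist _ p (mem_set Ap)); split=> // B C FB [D [[W oW WD] Dp DC]].
have Wp : W p by move: Dp; rewrite -WD.
have BF : F (set_val @^-1` (set_val @` B)) by apply: (filterS _ FB) => b Bb; exists b.
have [_ [[b Bb <-] Wb]] := pF _ _ BF (open_nbhs_nbhs (conj oW Wp)).
by exists b; split=> //; apply: DC; rewrite -WD.
Qed.

Lemma compact_cube : compact [set: cube R].
Proof.
have := @tychonoff nat (fun _ => (`[0, 1]%classic : set R)) (fun _ => [set: _])
  (fun _ => compact_set_type (@segment_compact R 0 1)).
by congr (compact _); apply/seteqP; split.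
Qed.

(** Heine-Cantor: a coordinate is continuous on the compact cube, hence uniformly continuous for
    every metric generating the topology. *)
Lemma coordinate_uniform_continuity (dpi : cube R -> cube R -> R) (i : nat) (eta : R) :
  is_metric dpi -> generates_topology dpi -> 0 < eta ->
  exists2 f : R, 0 < f & forall x y : cube R, dpi x y < f ->
    `|val (x i) - val (y i)| < eta.
Proof.
move=> [d0 deq dsym dtri] dgen e0.
have dball_open (x : cube R) (r : R) : open [set y | dpi x y < r].
  apply/dgen => y /= xy; exists (r - dpi x y); first by rewrite subr_gt0.
  by move=> z yz; apply: le_lt_trans (dtri _ y _) _; rewrite -ltrBDl.
have coord (x : cube R) : exists2 r : R, 0 < r & forall y, dpi x y < r ->
    `|val (x i) - val (y i)| < eta / 2.
  pose U : set (cube R) := [set y | `|val (x i) - val (y i)| < eta / 2].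
  have oU : open U.
    pose g (y : cube R) : R := set_val (y i).
    have cg : continuous g.
      move=> y; apply: (@continuous_comp _ _ _ (fun y : cube R => y i) set_val).
        exact: (@proj_continuous nat (fun _ => (`[0, 1]%classic : set R)) i y).
      exact: (@initial_continuous _ _ set_val).
    have -> : U = g @^-1` ball (val (x i)) (eta / 2).
      by apply/seteqP; split => y.
    by apply: open_comp => [y _|]; [exact: cg | exact: ball_open].
  have Ux : U x by rewrite /U /= subrr normr0 divr_gt0.
  by have [r r0 rU] := (dgen U).1 oU x Ux; exists r.
(* The filter of small positive radii is the parameter of the near-covering property, which turns
   pointwise radii into a uniform one. *)
have /compact_near_coveringP := compact_cube.
move=> /(_ R (0^'+) (fun e x => forall y, dpi x y < e -> `|val (x i) - val (y i)| < eta) _) H.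
have [|f /= f0 fH] := H.
  move=> x _; have [r r0 rx] := coord x.
  exists ([set y | dpi x y < r / 2], [set e | e < r / 2]) => /=.
    split; last by apply: nbhs_right_lt; rewrite divr_gt0.
    apply: open_nbhs_nbhs; split; first exact: dball_open.
    by rewrite /= (deq x x).2 // divr_gt0.
  move=> [x' e] /= [xx' er] y x'y.
  have -> : val (x' i) - val (y i) = (val (x i) - val (y i)) - (val (x i) - val (x' i)) by ring.
  apply: le_lt_trans (ler_normB _ _) _; rewrite (splitr eta); apply: ltrD; apply: rx.
    apply: le_lt_trans (dtri _ x' _) _; rewrite (splitr r); apply: ltrD => //.
    exact: lt_trans er.
  by apply: lt_trans xx' _; rewrite ltr_pdivrMr // ltr_pMr // ltr1n.
exists (f / 2); first by rewrite divr_gt0.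
move=> x y; apply: (fH (f / 2)) => //=.
  by rewrite /ball /= sub0r normrN gtr0_norm ?divr_gt0 // ltr_pdivrMr // ltr_pMr // ltr1n.
by rewrite divr_gt0.
Qed.
End CubeMetric.

(** * From close statistics to close local sums, and the case of bounded order *)

Section Assembly.
Variable R : realType.

(** A quantity determined by the [k]-ball is a function of the type of the [k.+1]-ball, the extra
    unit being the loss in [riso_loceq]. Only finitely many such types exist, so finitely many
    coordinates of the statistics control the sums. *)
Lemma stat_sum_close (d : nat) (alpha : nat -> nat * rooted_graph)
    (dpi : cube R -> cube R -> R) (k : nat) (eta : R) :
  enumerates_U d alpha -> is_metric dpi -> generates_topology dpi -> 0 < eta ->
  exists2 f : R, 0 < f & forall (G H : sgraph) (a : G -> R) (b : H -> R),
    max_degree_le d G -> max_degree_le d H -> #|G| = #|H| ->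
    d_stat dpi alpha G H < f ->
    (forall v, 0 <= a v <= 1) -> (forall w, 0 <= b w <= 1) ->
    (forall s v, bijective s -> loceq (@adj G) (@adj H) s k v -> a v = b (s v)) ->
    `|\sum_v a v - \sum_w b w| <= eta * #|G|%:R.
Proof.
move=> aE dm dg e0.
have [M HM] := finitely_many_types aE (ltn0Sn k).
(* The error is shared among [M] types; the successor keeps the divisor nonzero. *)
pose eta' := eta / M.+1%:R.
have e'0 : 0 < eta' by rewrite divr_gt0 // ltr0n.
have [f f0 Hf] : exists2 f : R, 0 < f & forall x y : cube R, dpi x y < f ->
    forall i, (i < M)%N -> `|val (x i) - val (y i)| < eta'.
  elim: (M) => [|m [f f0 Hf]]; first by exists 1.
  have [g g0 Hg] := coordinate_uniform_continuity m dm dg e'0.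
  exists (Num.min f g); first by rewrite lt_min f0 g0.
  move=> x y; rewrite lt_min => /andP[xf xg] i; rewrite ltnS leq_eqVlt => /orP[/eqP->|im].
    exact: Hg.
  exact: Hf.
exists f => // G H a b dG dH cGH st a01 b01 ab.
have typeP (X : sgraph) : max_degree_le d X -> exists typ : X -> 'I_M, forall v,
    (alpha (typ v)).1 = k.+1 /\ riso (rball k.+1 v) (alpha (typ v)).2.
  move=> dX.
  by have [t tP] := choice (fun v => HM X v dX); exists t.
have [tG tGP] := typeP G dG; have [tH tHP] := typeP H dH.
have uniq_type (X : sgraph) (dX : max_degree_le d X) (t : X -> 'I_M) (i : 'I_M) (v : X) :
    (forall v, (alpha (t v)).1 = k.+1 /\ riso (rball k.+1 v) (alpha (t v)).2) ->
    (alpha i).1 = k.+1 ->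
    (t v == i) = `[< riso (rball k.+1 v) (alpha i).2 >].
  move=> tP ik; apply/eqP/asboolP => [<-|vi]; first by have [] := tP v.
  have [j [_ ju]] := aE.2 k.+1 (rball k.+1 v) isT (in_U_rball _ _ dX).
  have [tk tv] := tP v; apply: val_inj => /=.
  rewrite -(ju (t v)); last by split=> //; apply: riso_sym.
  by apply: ju; split=> //; apply: riso_sym.
have G0 : 0 <= #|G|%:R :> R by rewrite ler0n.
apply: le_trans (type_sum_close (typ := tG) (typ' := tH) a01 b01 _) _.
  move=> v w vw; have [_ vA] := tGP v; have [_ wA] := tHP w; rewrite -vw in wA.
  have [s sb [<- L]] := riso_loceq cGH (ltn0Sn k) (riso_trans vA (riso_sym wA)).
  exact: ab.
apply: (@le_trans _ _ (\sum_(i < M) eta' * #|G|%:R)); last first.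
  rewrite sumr_const card_ord -[leLHS]mulr_natl mulrA; apply: ler_wpM2r => //.
  rewrite /eta' mulrCA ler_piMr //; first exact: ltW.
  by rewrite ler_pdivrMr ?ltr0n // mul1r ler_nat.
apply: ler_sum => i _.
(* An index below [M] belonging to another radius is the type of no vertex, so both its counts
   vanish. *)
have [ik|/eqP ik] := eqVneq (alpha i).1 k.+1; last first.
  have zero (X : finType) (t : X -> 'I_M) : (forall v, (alpha (t v)).1 = k.+1) ->
      #|[set v | t v == i]| = 0%N.
    move=> tk; apply: eq_card0 => v; rewrite inE; apply/negbTE/negP => /eqP vi.
    by apply: ik; rewrite -vi tk.
  rewrite !zero; [|by move=> v; have [] := tHP v|by move=> v; have [] := tGP v].
  by rewrite subrr normr0 mulr_ge0 // ltW.
have [G00|Gp] := posnP #|G|.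
  have card0 (X : finType) (A : {set X}) : #|X| = 0%N -> #|A| = 0%N.
    by move=> X0; apply/eqP; rewrite -leqn0 -X0 max_card.
  by rewrite (card0 G) // (card0 H) -?cGH // subrr normr0 mulr_ge0 // ltW.
have := Hf _ _ st i (ltn_ord i); rewrite /= /freq ik => H1.
rewrite -ler_pdivrMr ?ltr0n // -[X in _ / X]gtr0_norm ?ltr0n // -normf_div mulrBl.
apply: ltW; rewrite {2}cGH; move: H1; congr (`|_ / _ - _ / _| < _); congr (_%:R);
  apply: eq_card => v; rewrite !inE (uniq_type _ _ _ i) //.
Qed.

Lemma small_case (G H : sgraph) (d : nat) (K : nat) :
  max_degree_le d G -> max_degree_le d H -> #|G| = #|H| -> (#|G| <= K.+1)%N ->
  (forall c : code_type K, #|[set x | hascode (@adj G) c x]| =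
                           #|[set x | hascode (@adj H) c x]|) ->
  exists2 rho : G -> H, bijective rho & #|symdiff (edge_preim rho) (edges G)| = 0%N.
Proof.
move=> dG dH cGH GK cnt.
have [x|x|rho rb [B [B0 Bh]]] := @match_components G H (@adj G) (@adj H)
    (@adj_sym G) (@adj_sym H) K cGH.
- exact: leq_trans (max_card _) _.
- by apply: leq_trans (max_card _) _; rewrite -cGH.
exists rho => //; apply/eqP; rewrite -leqn0.
have {B0}B0 : #|B| = 0%N.
  by apply/eqP; rewrite -leqn0; apply: leq_trans B0 _; rewrite big1 // => c _; rewrite cnt subnn.
have := @card_symdiff G H d (@adj G) (@adj H) rho B set0 set0 dG dH rb.
rewrite !cards0 B0 muln0; apply=> //.
- by move=> x y ->.
- by move=> x y ->.
Qed.

End Assembly.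

(** * Graphs of large order: expected statistics, typical labellings and the error budget *)

Section LargeCase.
Variable R : realType.
Variables (K m T : nat).
Notation labels X := {ffun (X : finType) -> {ffun 'I_T -> bool}}.

Definition prob (G : sgraph) (c : option (code_type K)) (v : G) : R :=
  (\sum_(lam : labels G) (local_stat (@adj G) m c lam v)%:R) / #|{: labels G}|%:R.

Definition mean (G : sgraph) (c : option (code_type K)) : R :=
  (\sum_(lam : labels G) #|[set v | local_stat (@adj G) m c lam v]|%:R)
    / #|{: labels G}|%:R.

Lemma card_labels_gt0 (G : sgraph) : 0 < #|{: labels G}|%:R :> R.
Proof. by rewrite ltr0n card_ffun expn_gt0 card_ffun card_bool expn_gt0. Qed.

Lemma meanE (G : sgraph) c : mean G c = \sum_(v : G) prob c v.
Proof.
rewrite /mean /prob -mulr_suml exchange_big /=; congr (_ / _); apply: eq_bigr => lam _.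
rewrite -sum1dep_card natr_sum big_mkcond; apply: eq_bigr => v _.
by case: (local_stat _ _ _ _ _).
Qed.

Lemma prob_itv (G : sgraph) c (v : G) : 0 <= prob c v <= 1.
Proof.
have M0 := card_labels_gt0 G.
rewrite /prob divr_ge0 ?(ltW M0) ?sumr_ge0 //= ler_pdivrMr // mul1r.
by rewrite -sumr_const; apply: ler_sum => lam _; case: (local_stat _ _ _ _ _).
Qed.

(** Relabelling along [s] is a bijection between the labellings of the two graphs, under which the
    statistic at [v] agrees with that at [s v]. *)
Lemma prob_local (G H : sgraph) c (s : G -> H) v : bijective s ->
  loceq (@adj G) (@adj H) s (stat_radius K T) v -> prob c v = prob c (s v).
Proof.
move=> sb L; have [s' sK s'K] := sb.
have cGH : #|G| = #|H| := bij_eq_card sb.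
rewrite /prob !card_ffun cGH; congr (_ / _).
rewrite (reindex (fun lam : labels G => [ffun y => lam (s' y)] : labels H)) /=; last first.
  exists (fun lam => [ffun x => lam (s x)]) => lam _; apply/ffunP => x.
    by rewrite !ffunE sK.
  by rewrite !ffunE s'K.
apply: eq_bigr => lam _; congr (nat_of_bool _)%:R; apply/esym.
apply: local_stat_local => // [|x _]; first exact: adj_sym.
by rewrite ffunE sK.
Qed.

(** Two [r]-balls meet only if their centres are within [2 r], which gives [D] in [concentration].
    The size assumption puts its bound below the square of [kappa * #|G|]. *)
Lemma typical_labels (G : sgraph) (d : nat) (kappa : R) : max_degree_le d G ->
  0 < kappa ->
  (#|{: option (code_type K)}| * d.+1 ^ (stat_radius K T + stat_radius K T))%:R
    <= kappa ^+ 2 * #|G|%:R ->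
  exists lam : labels G, forall c,
    `|#|[set v | local_stat (@adj G) m c lam v]|%:R - mean G c| <= kappa * #|G|%:R.
Proof.
move=> dG k0 big; set r := stat_radius K T in big.
have [| | |lam Hlam] := @concentration R G {ffun 'I_T -> bool} (option (code_type K))
  (fun c lam v => local_stat (@adj G) m c lam v) (nball (@adj G) r) (d.+1 ^ (r + r)).
- by rewrite card_ffun card_bool expn_gt0.
- move=> c v a b ab; have L : loceq (@adj G) (@adj G) id r v by [].
  apply: (local_stat_local m c (@adj_sym G) _ L); first by exists id.
  by move=> x xv; rewrite ab.
- move=> v; apply: leq_trans (card_nball _ _ dG); apply: subset_leq_card.
  apply/subsetP => w; rewrite inE -setI_eq0 => /set0Pn[x]; rewrite inE => /andP[xv xw].
  by apply: nball_trans xv (nball_sym _ xw); apply: adj_sym.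
exists lam => c; have n0 : 0 <= kappa * #|G|%:R by rewrite mulr_ge0 // ltW.
rewrite -(@ler_pXn2r _ 2) ?nnegrE // real_normK ?num_real //.
apply: le_trans (_ : _ <= (#|{: option (code_type K)}| * (#|G| * d.+1 ^ (r + r)))%:R) _.
  apply: le_trans Hlam; rewrite (bigD1 c) //= lerDl.
  by apply: sumr_ge0 => i _; apply: sqr_ge0.
have -> : (kappa * #|G|%:R) ^+ 2 = #|G|%:R * (kappa ^+ 2 * #|G|%:R) by ring.
by rewrite mulnCA natrM; apply: ler_wpM2l.
Qed.

Lemma mean_leftover (G : sgraph) (d : nat) (Z : {set G}) : max_degree_le d G ->
  (0 < T)%N -> (forall x : G, (#|connect (adj_off Z) x| <= K)%N) ->
  mean G None <= (2 ^ (d.+1 ^ K))%:R / T%:R * #|G|%:R + (1 + m * d)%:R * #|Z|%:R.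
Proof.
move=> dG T0 hZ.
have hZ' (x : G) : (#|connect (relX (@adj G) (~: Z)) x| <= K)%N.
  rewrite (_ : #|_| = #|connect (adj_off Z) x|) //.
  apply: eq_card => y; apply: eq_connect => a b.
  by rewrite /relX /adj_off !inE.
have := @sum_leftover G (@adj G) K m T (@adj_sym G) d Z dG hZ'.
rewrite -(ler_nat R) natrM natr_sum => H.
rewrite /mean ler_pdivrMr ?card_labels_gt0 //.
have T0' : 0 < T%:R :> R by rewrite ltr0n.
rewrite -(ler_pM2l T0') mulr_sumr.
apply: le_trans (_ : _ <= _) (le_trans H _).
  apply: ler_sum => lam _; rewrite natrM; apply: ler_wpM2l; first exact: ltW.
  by rewrite ler_nat; apply: subset_leq_card; apply/subsetP => v; rewrite inE.
rewrite !natrD !natrM le_eqVlt; apply/orP; left; apply/eqP.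
by field; rewrite gt_eqF.
Qed.

(** The first term is the boundary of the pieces in both graphs, the second the edges at leftover
    vertices. A separator is assumed only for [G]; the leftover of [H] is compared with that of [G]
    through the means. The two leftovers deviate by [kappa * n] and twice that, which gives the 3.
    Each code contributes [3 * kappa * n] to [B], with weight [2 * d], which gives the 6. *)
Lemma large_case (G H : sgraph) (d : nat) (Z : {set G}) (kappa : R) :
  max_degree_le d G -> max_degree_le d H -> #|G| = #|H| -> (0 < T)%N -> (0 < m)%N ->
  (forall x : G, (#|connect (adj_off Z) x| <= K)%N) -> 0 < kappa ->
  (#|{: option (code_type K)}| * d.+1 ^ (stat_radius K T + stat_radius K T))%:R
    <= kappa ^+ 2 * #|G|%:R ->
  (forall c, `|mean G c - mean H c| <= kappa * #|G|%:R) ->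
  exists2 rho : G -> H, bijective rho &
    #|symdiff (edge_preim rho) (edges G)|%:R <=
    2 / m%:R * #|G|%:R
    + d%:R * 2 * ((2 ^ (d.+1 ^ K))%:R / T%:R * #|G|%:R + (1 + m * d)%:R * #|Z|%:R)
    + d%:R * (3 + 6 * #|{: code_type K}|%:R) * kappa * #|G|%:R.
Proof.
move=> dG dH cGH T0 m0 hZ k0 big mGH; set n : R := #|G|%:R in big mGH *.
have [lG HG] := typical_labels dG k0 big.
have [lH HH] : exists lam : labels H, forall c,
    `|#|[set v | local_stat (@adj H) m c lam v]|%:R - mean H c| <= kappa * n.
  by rewrite /n cGH; apply: typical_labels => //; rewrite -cGH.
rewrite -/n in HG.
pose eG := piece (@adj G) K m (act lG) T; pose eH := piece (@adj H) K m (act lH) T.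
pose UG := remain (@adj G) K m (act lG) T; pose UH := remain (@adj H) K m (act lH) T.
have [x|x|rho rb [B [B0 Bh]]] := @match_components G H eG eH
    (piece_sym _ _ (@adj_sym G) _ _) (piece_sym _ _ (@adj_sym H) _ _) K cGH.
- exact: piece_card _ _ (@adj_sym G) _ _ _.
- exact: piece_card _ _ (@adj_sym H) _ _ _.
exists rho => //.
have := @card_symdiff G H d eG eH rho B (cut (@adj G) K m (act lG) T)
   (cut (@adj H) K m (act lH) T) dG dH rb (@piece_sub _ _ _ _ _ _) (@piece_sub _ _ _ _ _ _)
   Bh (@cut_complete _ _ K m (@adj_sym G) (act lG) T)
   (@cut_complete _ _ K m (@adj_sym H) (act lH) T).
rewrite -(ler_nat R) => /le_trans; apply.
have cutG := card_cut K m (@adj_sym G) (act lG) T dG.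
have cutH := card_cut K m (@adj_sym H) (act lH) T dH.
have UGle : #|UG|%:R <= mean G None + kappa * n.
  have := HG None; rewrite ler_distl => /andP[_]; apply: le_trans.
  by rewrite ler_nat; apply: subset_leq_card; apply/subsetP => v; rewrite inE.
have UHle : #|UH|%:R <= mean H None + kappa * n.
  have := HH None; rewrite ler_distl => /andP[_]; apply: le_trans.
  by rewrite ler_nat; apply: subset_leq_card; apply/subsetP => v; rewrite inE.
have mle := mean_leftover dG T0 hZ; rewrite -/n in mle.
have mHG : mean H None <= mean G None + kappa * n.
  by have := mGH None; rewrite distrC ler_distl => /andP[].
have Ble : #|B|%:R <= #|{: code_type K}|%:R * (3 * kappa * n).
  apply: le_trans (_ : _ <= _) (_ : \sum_(c : code_type K) 3 * kappa * n <= _).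
    move: B0; rewrite -(ler_nat R) => /le_trans; apply; rewrite natr_sum.
    apply: ler_sum => c _.
    have kn : 0 <= kappa * n by rewrite mulr_ge0 ?(ltW k0) // /n ler0n.
    have [le|lt] := leqP #|[set x | hascode eG c x]| #|[set x | hascode eH c x]|.
      move: le; rewrite -subn_eq0 => /eqP ->; rewrite -mulrA mulr_ge0 //.
    rewrite natrB ?(ltnW lt) //.
    (* Two sampling errors and the difference of the means, each at most [kappa * n]. *)
    have := HG (Some c); rewrite ler_distl => /andP[_ h1].
    have := HH (Some c); rewrite ler_distl => /andP[h2 _].
    have := mGH (Some c); rewrite ler_distl => /andP[_ h3].
    rewrite /= -/eG -/eH in h1 h2.
    lra.
  by rewrite sumr_const -[leLHS]mulr_natl.
have m0' : 0 < m%:R :> R by rewrite ltr0n.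
have cG : #|cut (@adj G) K m (act lG) T|%:R <= d%:R * #|UG|%:R + n / m%:R.
  rewrite -(ler_pM2l m0') -[leLHS]natrM.
  move: cutG; rewrite -(ler_nat R) => /le_trans; apply.
  rewrite !natrD !natrM /n -/UG le_eqVlt; apply/orP; left; apply/eqP; field.
  by rewrite gt_eqF.
have cH : #|cut (@adj H) K m (act lH) T|%:R <= d%:R * #|UH|%:R + n / m%:R.
  rewrite -(ler_pM2l m0') -[leLHS]natrM.
  move: cutH; rewrite -(ler_nat R) => /le_trans; apply.
  rewrite !natrD !natrM /n cGH -/UH le_eqVlt; apply/orP; left; apply/eqP; field.
  by rewrite gt_eqF.
rewrite !natrD !natrM in mle *.
set b := (X in mean G None <= X) in mle.
rewrite -/b.
have d0 : 0 <= d%:R :> R by rewrite ler0n.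
have hU : d%:R * #|UG|%:R + d%:R * #|UH|%:R <= d%:R * (2 * b + 3 * kappa * n).
  by rewrite -mulrDr ler_wpM2l //; lra.
have hB : 2 * d%:R * #|B|%:R <= 2 * d%:R * (#|{: code_type K}|%:R * (3 * kappa * n)).
  by rewrite ler_wpM2l // mulr_ge0.
apply: le_trans (lerD (lerD cG cH) hB) _.
have -> : 2 / m%:R * n = n / m%:R + n / m%:R by field; rewrite gt_eqF.
move: hU hB; set q := n / m%:R; lra.
Qed.

End LargeCase.

(** * Choice of the constants and conclusion *)

Lemma natr_close_eq (R : realDomainType) (p q : nat) : `|p%:R - q%:R| < 1 :> R -> p = q.
Proof.
move=> h; have : `|p%:Z - q%:Z| < 1 by rewrite -(ltr_int R) intr_norm rmorphB.
lia.
Qed.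

Theorem theorem5 (R : realType) (d : nat) (d_ge1 : (1 <= d)%N)
    (alpha : nat -> nat * rooted_graph) (alpha_enum : enumerates_U d alpha)
    (dpi : cube R -> cube R -> R)
    (dpi_metric : is_metric dpi) (dpi_top : generates_topology dpi)
    (P : sgraph -> Prop) (P_deg : forall G, P G -> max_degree_le d G)
    (P_hyp : hyperfinite R P) :
  forall delta : R, 0 < delta ->
  exists2 f : R, 0 < f &
  forall (G H : sgraph) (n : nat),
    P G -> max_degree_le d H -> #|G| = n -> #|H| = n ->
    d_stat dpi alpha G H < f ->
    exists2 rho : G -> H, bijective rho &
      #|symdiff (edge_preim rho) (edges G)|%:R < delta * n%:R.
Proof.
move=> delta delta0.
have d0 : 0 < d%:R :> R by rewrite ltr0n.
pose e := delta / 5; have e0 : 0 < e by rewrite divr_gt0.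
(* Each of the four error terms of large_case is at most e n = delta n / 5. *)
have small (x y : R) : 0 < x -> 0 < y -> exists2 k : nat, (0 < k)%N & x / k%:R <= y.
  move=> x0 y0; have xy : 0 <= x / y by rewrite divr_ge0 ?ltW.
  exists (Num.Def.archi_bound (x / y)).+1 => //.
  rewrite ler_pdivrMr ?ltr0n // mulrC -ler_pdivrMr //.
  apply: ltW; apply: lt_trans (archi_boundP xy) _.
  by rewrite ltr_nat.
(* The order of the choices matters: [eps] depends on [m], [K] on [eps], both [T] and [kappa] on
   [K], and [n0] on [K], [T] and [kappa]. *)
have [m m0 hm] := small 2 e (ltr0Sn R 1) e0.
pose eps := e / (d%:R * 2 * (1 + m * d)%:R).
have eps0 : 0 < eps by rewrite divr_gt0 // !mulr_gt0 // ltr0n.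
have [K _ HK] := P_hyp eps eps0.
have N0 : 0 < d%:R * 2 * (2 ^ (d.+1 ^ K))%:R :> R by rewrite !mulr_gt0 // ltr0n expn_gt0.
have [T T0 hT] := small _ e N0 e0.
pose w : R := d%:R * (3 + 6 * #|{: code_type K}|%:R).
have w0 : 0 < w by rewrite mulr_gt0 // ltr_wpDr // mulr_ge0.
pose kappa := e / w; have k0 : 0 < kappa by rewrite divr_gt0.
(* From [n0] vertices on, the size assumption of [typical_labels] holds; the successor in the
   numerator only ensures positivity. *)
have [n0 n00 hn0] := small _ _ (ltr0Sn R (#|{: option (code_type K)}| *
   d.+1 ^ (stat_radius K T + stat_radius K T))) (exprn_gt0 2 k0).
have [f1 f10 Hf1] := stat_sum_close (stat_radius K T) alpha_enum dpi_metric dpi_top k0.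
(* For orders below [n0], with this precision the numbers of vertices having a given code differ by
   less than 1, hence agree. The radius [n0.+1] covers every component of such a graph. *)
have i0 : 0 < n0.+1%:R^-1 :> R by rewrite invr_gt0 ltr0n.
have [f2 f20 Hf2] := stat_sum_close n0.+1 alpha_enum dpi_metric dpi_top i0.
exists (Num.min f1 f2); first by rewrite lt_min f10 f20.
move=> G H n PG dH cG cH; rewrite lt_min => /andP[st1 st2].
have dG := P_deg _ PG; have cGH : #|G| = #|H| by rewrite cG cH.
have [Z hZ cZ] := HK G PG.
have n_gt0 : 0 < n%:R :> R.
  rewrite ltr0n lt0n; apply/eqP => nz; move: hZ; rewrite cG nz mulr0.
  by rewrite ltNge ler0n.
have [nn0|nn0] := ltnP n n0.
  have GK : (#|G| <= n0.+1)%N by rewrite cG leqW // ltnW.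
  have [c|rho rb rho0] := @small_case G H d n0 dG dH cGH GK.
    pose a (X : sgraph) (v : X) : R := (hascode (@adj X) c v)%:R.
    have sumE (X : sgraph) : \sum_(v : X) a X v = #|[set x : X | hascode (@adj X) c x]|%:R.
      rewrite -sum1dep_card natr_sum [RHS]big_mkcond; apply: eq_bigr => v _.
      by rewrite /a; case: hascode.
    have a01 (X : sgraph) (v : X) : 0 <= a X v <= 1.
      by rewrite /a; case: hascode; rewrite ?ler01 ?lexx.
    have loc s v : bijective s -> loceq (@adj G) (@adj H) s n0.+1 v -> a G v = a H (s v).
      move=> sb L; rewrite /a (loceq_hascode _ sb L) //.
      exact: leq_trans (max_card _) GK.
    have := Hf2 G H (a G) (a H) dG dH cGH st2 (a01 G) (a01 H) loc.
    rewrite !sumE cG => ab.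
    apply: (natr_close_eq (R := R)); apply: le_lt_trans ab _.
    by rewrite mulrC ltr_pdivrMr ?ltr0n // mul1r ltr_nat ltnW.
  by exists rho => //; rewrite rho0 mulr_gt0.
have [|c|rho rb Hrho] := @large_case R K m T G H d Z kappa dG dH cGH T0 m0 cZ k0.
- rewrite cG; apply: (@le_trans _ _ (kappa ^+ 2 * n0%:R)); last first.
    by rewrite ler_wpM2l ?sqr_ge0 // ler_nat.
  by rewrite -ler_pdivrMr ?ltr0n //; apply: le_trans hn0; rewrite ler_wpM2r ?invr_ge0 // ler_nat.
- rewrite !meanE; apply: Hf1 => //; try by move=> v; apply: prob_itv.
  by move=> s v sb L; apply: prob_local.
exists rho => //; apply: le_lt_trans Hrho _; rewrite cG.
have h1 : 2 / m%:R * n%:R <= e * n%:R by rewrite ler_pM2r.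
have h2 : d%:R * 2 * ((2 ^ (d.+1 ^ K))%:R / T%:R * n%:R) <= e * n%:R.
  by rewrite mulrA ler_pM2r // mulrA.
have h3 : d%:R * 2 * ((1 + m * d)%:R * #|Z|%:R) <= e * n%:R.
  have c0 : 0 < d%:R * 2 * (1 + m * d)%:R :> R by rewrite !mulr_gt0 // ltr0n.
  rewrite mulrA -ler_pdivlMl //; move: (ltW hZ); rewrite cG /eps => /le_trans; apply.
  by rewrite mulrA [_^-1 * e]mulrC.
have h4 : d%:R * (3 + 6 * #|{: code_type K}|%:R) * kappa * n%:R = e * n%:R.
  by rewrite -/w /kappa mulrCA divff ?mulr1 // gt_eqF.
rewrite h4 mulrDr.
(* The four error terms use four fifths of [delta * n]; the remaining fifth makes the inequality
   strict. *)
have h5 : delta * n%:R = 5 * (e * n%:R) by rewrite /e; field.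
have h6 : 0 < e * n%:R by rewrite mulr_gt0.
lra.
Qed.
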